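(* Let $C$ be a compact Riemann surface of genus $g$ represented by a possibly singular affine plane curve $C^o\subset\mathbb{C}^2$ defined by an irreducible polynomial $f(x,y)\in\mathbb{Q}[x,y]$ of degree $d$ in which $y^d$ appears with nonzero coefficient. Let $h_1,\dots,h_g\in\mathbb{Q}[x,y]$ be such that the differentials $\omega_i=H_i\,dx$ with $H_i=h_i/f_y$ ($i=1,\dots,g$) form a basis of $H^0(C,\Omega^1_C)$. Let $K$ be the field of fractions of $\mathbb{Q}[x,y]/\langle f\rangle$. Then the formulas $$U=-(H_1,\dots,H_g)^T,\qquad V=-(\dot H_1,\dots,\dot H_g)^T,\qquad W=-\tfrac12(\ddot H_1,\dots,\ddot H_g)^T,$$ composed with the group action $$(U,V,W)\ \mapsto\ \bigl(aU,\ 2bU+a^2V,\ cU+3abV+a^3W\bigr),$$ give an algebraic parametrization of the Dubrovin threefold $\mathcal{D}_C\subset\mathbb{WP}^{3g-1}$. This parametrization has coordinates in $K[a,b,c]$.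
   Context: Here $f_y=\partial f/\partial y$. The $y$-coordinate on $C^o$ is viewed as a (multi-valued) function $y=y(x)$ of $x$, so that $x$ is a local parameter, and the dots in $\dot H_i,\ddot H_i$ denote first and second derivatives of $H_i(x,y(x))$ with respect to $x$. The irreducible polynomial $f$ defines an irreducible complex curve $C^o$. The quantities $a,b,c$ are free parameters ($a\neq0$). $\mathbb{WP}^{3g-1}$ is the weighted projective space with coordinates $u_i,v_i,w_i$ ($1\le i\le g$) of degrees $1,2,3$ respectively. Dubrovin threefold (with respect to the basis $\omega_1,\dots,\omega_g$). For $p\in C$ and a local coordinate $z$ at $p$, write $\omega_i=H_i(z)\,dz$ and form the point $(U,V,W)=-(H_1,\dots,H_g,\dot H_1,\dots,\dot H_g,\tfrac12\ddot H_1,\dots,\tfrac12\ddot H_g)(p)\in\mathbb{WP}^{3g-1}$, where dots denote derivatives with respect to $z$. The group $G$ of matrices $\begin{pmatrix} a&0&0\\2b&a^2&0\\c&3ab&a^3\end{pmatrix}$ with $a\in\mathbb{C}^*$, $b,c\in\mathbb{C}$, acts on $\mathbb{WP}^{3g-1}$ by $u_i\mapsto au_i$, $v_i\mapsto2bu_i+a^2v_i$, $w_i\mapsto cu_i+3abv_i+a^3w_i$; a change of local coordinate moves the point within its $G$-orbit. $\mathcal{D}_C$ is the (Zariski closure of the) union of the $G$-orbits of these points over all $p\in C$. ''Algebraic parametrization'' means a rational map, with the $3g$ coordinates given by the displayed expressions in $a,b,c$ and a point $(x,y)$ of $C^o$, whose image is Zariski dense in $\mathcal{D}_C$. *)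

(* Defs.v *)
From HB Require Import structures.
From mathcomp Require Import all_boot all_order all_algebra.
From mathcomp Require Import complex.
(* The notations of mpoly clash with those of all_analysis, hence [mpoly n A]
   below for the polynomial ring A[X_0, ..., X_(n-1)]. *)
From mathcomp Require Import -(notations) mpoly.
From mathcomp Require Import all_classical all_reals all_analysis.

Set Implicit Arguments.
Unset Strict Implicit.
Unset Printing Implicit Defensive.

Import Order.TTheory GRing.Theory Num.Theory numFieldNormedType.Exports.

Local Open Scope classical_set_scope.
Local Open Scope ring_scope.
Local Open Scope complex_scope.
Local Open Scope quotient_scope.

(* The complex numbers R[i] carry their topology and their structure of normed
   module over themselves through the alias R[i]^o. *)

Section RiemannSurfaces.
Context {R : realType}.
Local Notation C := (R[i]^o).

(* Holomorphic in Weierstrass's sense: the sum of a power series near c. *)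
Definition holomorphic_at (G : C -> C) (c : C) : Prop :=
  exists a : nat -> C,
    \forall z \near c, series (fun n => a n * (z - c) ^+ n) @ \oo --> G z.

(* Near p, the function w is a holomorphic function of the function z. *)
Definition holomorphic_wrt (T : topologicalType) (z w : T -> C) (p : T) : Prop :=
  exists2 G : C -> C, holomorphic_at G (z p) &
    \forall q \near p, w q = G (z q).

Definition is_chart (T : topologicalType) (U : set T) (phi : T -> C) : Prop :=
  [/\ open U,
      set_inj U phi,
      forall p, U p -> {for p, continuous phi}
    & forall V, open V -> V `<=` U -> open (phi @` V)].

Record riemann_surface := RiemannSurface {
  rs_space :> topologicalType;
  rs_atlas : set (set rs_space * (rs_space -> C));
  rs_hausdorff : hausdorff_space rs_space;
  rs_connected : connected [set: rs_space];
  rs_chart : forall U phi, rs_atlas (U, phi) -> is_chart U phi;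
  rs_cover : forall p, exists U phi, rs_atlas (U, phi) /\ U p;
  rs_compat : forall U phi V psi p, rs_atlas (U, phi) -> rs_atlas (V, psi) ->
    U p -> V p -> holomorphic_wrt phi psi p }.

(* A chart of the maximal atlas around p; z is not required to vanish at p. *)
Definition local_coordinate (X : riemann_surface) (p : X) (z : X -> C) : Prop :=
  exists V : set X, [/\ V p, is_chart V z
    & forall U phi q, rs_atlas (U, phi) -> U q -> V q ->
        holomorphic_wrt phi z q /\ holomorphic_wrt z phi q].

(* A differential eta is represented by its coefficients: eta p z is the
   value at p of eta / dz, which is meaningful when z is a local coordinate
   at p. *)
Definition differential (X : riemann_surface) := X -> (X -> C) -> C.

Definition holomorphic_differential (X : riemann_surface)
    (eta : differential X) : Prop :=
  (forall (p : X) (z w : X -> C) (G : C -> C),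
     local_coordinate p z -> local_coordinate p w ->
     holomorphic_at G (z p) -> (\forall q \near p, w q = G (z q)) ->
     eta p z = eta p w * derive1 G (z p)) /\
  (forall (p : X) (z : X -> C), local_coordinate p z ->
     holomorphic_wrt z (fun q => eta q z) p).

(* omega is a basis of the space of holomorphic differentials of X; in
   particular g is the genus of X when X is compact. *)
Definition differential_basis (X : riemann_surface) (g : nat)
    (omega : 'I_g -> differential X) : Prop :=
  (forall i, holomorphic_differential (omega i)) /\
  (forall eta : differential X, holomorphic_differential eta ->
     exists! l : 'rV[R[i]]_g, forall (p : X) (z : X -> C),
       local_coordinate p z -> eta p z = \sum_(i < g) l 0 i * omega i p z).

End RiemannSurfaces.

Arguments riemann_surface : clear implicits.

Section WeightedProjectiveSpace.
Context {R : realType} {g : nat}.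

(* A point of the affine cone over WP^(3g-1) is a 3 x g matrix with rows
   u, v, w; the row of index j has degree j.+1. *)
Definition wscale (t : R[i]) : 'M[R[i]]_3 := diag_mx (\row_j t ^+ j.+1).

Definition wcone := {M : 'M[R[i]]_(3, g) | M != 0}.

Definition wequiv (M N : wcone) : bool :=
  `[< exists2 t : R[i], t != 0 & val N = wscale t *m val M >].

Lemma wscaleM s t : wscale s *m wscale t = wscale (s * t).
Proof.
rewrite /wscale mulmx_diag; congr diag_mx; apply/rowP => j.
by rewrite !mxE exprMn.
Qed.

Lemma wscale1 : wscale 1 = 1%:M.
Proof.
apply/matrixP => i j; rewrite !mxE expr1n.
by case: (i == j).
Qed.

Lemma wequiv_refl : reflexive wequiv.
Proof.
move=> M; apply/asboolP; exists 1; first exact: oner_neq0.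
by rewrite wscale1 mul1mx.
Qed.

Lemma wequiv_sym : ssrbool.symmetric wequiv.
Proof.
suff H M N : wequiv M N -> wequiv N M by move=> M N; apply/idP/idP; exact: H.
move=> /asboolP[t t0 e]; apply/asboolP; exists t^-1; first by rewrite invr_eq0.
by rewrite e mulmxA wscaleM mulVf// wscale1 mul1mx.
Qed.

Lemma wequiv_trans : transitive wequiv.
Proof.
move=> N M P /asboolP[s s0 e] /asboolP[t t0 e']; apply/asboolP; exists (t * s).
  by rewrite mulf_neq0.
by rewrite e' e mulmxA wscaleM.
Qed.

Canonical wequiv_equiv := EquivRel wequiv wequiv_refl wequiv_sym wequiv_trans.

Definition WP := {eq_quot wequiv}.
HB.instance Definition _ := EqQuotient.on WP.

(* P is the point with weighted homogeneous coordinates M. *)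
Definition wcoords (P : WP) (M : 'M[R[i]]_(3, g)) : Prop :=
  exists nz : M != 0, P = \pi_WP (exist _ M nz).

(* Polynomials in the 3g coordinates, the variable of index k being the entry
   (enum_val k) of the 3 x g matrix. *)
Definition wpoly := mpoly #|{: 'I_3 * 'I_g}| R[i].

Definition whomogeneous (F : wpoly) : Prop :=
  exists e : nat, forall m, m \in msupp F ->
    (\sum_k m k * (enum_val k).1.+1)%N = e.

Definition weval (F : wpoly) (M : 'M[R[i]]_(3, g)) : R[i] :=
  meval (fun k => M (enum_val k).1 (enum_val k).2) F.

Definition zariski_closed (Z : set WP) : Prop :=
  exists2 I : set wpoly, (forall F, I F -> whomogeneous F) &
    Z = [set P | forall F, I F -> weval F (val (repr P)) = 0].

Definition zariski_closure (A : set WP) : set WP := smallest zariski_closed A.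

Definition zariski_dense_in (A Z : set WP) : Prop :=
  A `<=` Z /\ Z `<=` zariski_closure A.

End WeightedProjectiveSpace.

Arguments WP : clear implicits.

Section DubrovinThreefold.
Context {R : realType} {g : nat}.
Local Notation C := (R[i]^o).

Definition Gmx (a b c : R[i]) : 'M[R[i]]_3 :=
  \matrix_(j, k) nth 0 (nth [::]
    [:: [:: a;      0;          0];
        [:: 2 * b;  a ^+ 2;     0];
        [:: c;      3 * a * b;  a ^+ 3]] j) k.

(* The rows are U, V, W for the functions H of one variable, at z0. *)
Definition UVW (H : 'I_g -> C -> C) (z0 : C) : 'M[R[i]]_(3, g) :=
  \matrix_(j, i) nth 0 [:: - H i z0; - derive1 (H i) z0; - (2^-1 * derive1n 2 (H i) z0)] j.

Definition Gorbits (X : riemann_surface R) (omega : 'I_g -> differential X) :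
    set (WP R g) :=
  [set P | exists (p : X) (z : X -> C) (H : 'I_g -> C -> C) (a b c : R[i]),
    [/\ local_coordinate p z,
        forall i, \forall q \near p, omega i q z = H i (z q),
        a != 0
      & wcoords P (Gmx a b c *m UVW H (z p))]].

Definition dubrovin_threefold (X : riemann_surface R)
    (omega : 'I_g -> differential X) : set (WP R g) :=
  zariski_closure (Gorbits omega).

End DubrovinThreefold.

Definition irreducible_elt (A : idomainType) (u : A) : Prop :=
  [/\ u != 0, u \isn't a GRing.unit
    & forall v w : A, u = v * w -> v \is a GRing.unit \/ w \is a GRing.unit].

Section PlaneCurves.
Context {R : realType}.
Local Notation C := (R[i]^o).
Implicit Types f p q : mpoly 2 rat.

(* In Q[x, y] the variable x has index ord0 and y has index ord_max. *)
Definition ev p (x y : R[i]) : R[i] :=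
  meval (fun k : 'I_2 => [:: x; y]`_k) (map_mpoly ratr p).

Definition dx p : mpoly 2 rat := mderiv ord0 p.
Definition dy p : mpoly 2 rat := mderiv ord_max p.

Definition smooth_locus f : set (C * C) :=
  [set P | ev f P.1 P.2 = 0 /\ (ev (dx f) P.1 P.2 != 0 \/ ev (dy f) P.1 P.2 != 0)].

(* X is obtained from the curve f = 0: (x, y) is a biholomorphic map from the
   complement of a finite set S onto the smooth locus, on which x (resp. y) is
   a local coordinate wherever the partial derivative of f with respect to y
   (resp. x) is nonzero.  This determines a compact X up to isomorphism. *)
Definition plane_model (X : riemann_surface R) f (S : set X) (x y : X -> C) :
    Prop :=
  [/\ finite_set S,
      set_bij (~` S) (smooth_locus f) (fun p : X => (x p, y p)),
      (forall p : X, ~ S p -> ev (dy f) (x p) (y p) != 0 ->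
         local_coordinate p x /\ holomorphic_wrt x y p)
    & (forall p : X, ~ S p -> ev (dx f) (x p) (y p) != 0 ->
         local_coordinate p y /\ holomorphic_wrt y x p)].

(* y is a branch near x0 of the multivalued function defined by f(x, y) = 0,
   and x is a local parameter at the point (x0, y x0). *)
Definition branch f (x0 : C) (y : C -> C) : Prop :=
  [/\ holomorphic_at y x0,
      \forall x \near x0, ev f x (y x) = 0
    & ev (dy f) x0 (y x0) != 0].

Definition Hbranch (g : nat) f (h : 'I_g -> mpoly 2 rat) (y : C -> C) :
    'I_g -> C -> C :=
  fun i x => ev (h i) x (y x) / ev (dy f) x (y x).

(* The parametrization at the point (x0, y x0) and parameters a, b, c. *)
Definition param (g : nat) f (h : 'I_g -> mpoly 2 rat) (x0 : C) (y : C -> C)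
    (a b c : R[i]) : 'M[R[i]]_(3, g) :=
  Gmx a b c *m UVW (Hbranch f h y) x0.

Definition param_image (g : nat) f (h : 'I_g -> mpoly 2 rat) : set (WP R g) :=
  [set P | exists (x0 : C) (y : C -> C) (a b c : R[i]),
    [/\ branch f x0 y, a != 0 & wcoords P (param f h x0 y a b c)]].

End PlaneCurves.

Section FunctionField.
Variables (K : fieldType) (iota : {rmorphism mpoly 2 rat -> K}).

(* K, with iota : Q[x, y] -> K, is the field of fractions of Q[x, y] / (f). *)
Definition is_fraction_field (f : mpoly 2 rat) : Prop :=
  (forall p, iota p = 0 <-> exists q, p = q * f) /\
  (forall k : K, exists p q, iota q != 0 /\ k = iota p / iota q).

(* The element k of K is regular at the point (x, y), with value v. *)
Definition has_value (R : realType) (x y : R[i]) (k : K) (v : R[i]) : Prop :=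
  exists p q, [/\ k = iota p / iota q, ev q x y != 0 & v = ev p x y / ev q x y].

(* The variables of K[a, b, c] have indices 0, 1, 2 in this order; A is the
   specialization of Q at the point (x, y), coefficient by coefficient. *)
Definition specializes (R : realType) (x y : R[i])
    (Q : mpoly 3 K) (A : mpoly 3 R[i]) : Prop :=
  forall m, has_value x y (mcoeff m Q) (mcoeff m A).

(* The 3g coordinates of the parametrization are given by elements of
   K[a, b, c]. *)
Definition coordinates_in_Kabc (R : realType) (g : nat) (f : mpoly 2 rat)
    (h : 'I_g -> mpoly 2 rat) : Prop :=
  exists Q : 'I_3 -> 'I_g -> mpoly 3 K,
    forall (x0 : R[i]^o) (y : R[i]^o -> R[i]^o), branch f x0 y ->
    forall j i, exists2 A : mpoly 3 R[i],
      specializes x0 (y x0) (Q j i) A &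
      forall a b c : R[i], a != 0 ->
        param f h x0 y a b c j i = meval (fun k : 'I_3 => [:: a; b; c]`_k) A.

End FunctionField.

(* Main.v *)
Require Import Defs.
From HB Require Import structures.
From mathcomp Require Import all_boot all_order all_algebra.
From mathcomp Require Import complex ring.
From mathcomp Require Import -(notations) mpoly.
From mathcomp Require Import all_classical all_reals all_analysis.

Set Implicit Arguments.
Unset Strict Implicit.
Unset Printing Implicit Defensive.

Import Order.TTheory GRing.Theory Num.Theory numFieldNormedType.Exports.

Local Open Scope classical_set_scope.
Local Open Scope ring_scope.
Local Open Scope complex_scope.

(** On the locus [f_y <> 0] of the curve, x is a local coordinate and a root of
    [f(x, .)] through a given point is unique, so the parametrization runs through
    the G-orbits of the points of that locus.  For density, let F be a weighted
    homogeneous polynomial vanishing on its image.  A change of coordinate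
    [w = G z] acts on (U, V, W) by the element of the group with [a = G'],
    [b = G'' / 2], [c = G''' / 2], hence F vanishes on the orbits of all points with
    [f_y <> 0], whatever the local coordinate.  Such points are dense in X: where
    [f_y] vanishes identically, [f_x dx + f_y dy = 0] makes x locally constant, and
    then [f(x, .)] has infinitely many roots although its leading coefficient is
    that of [y^d].  By continuity F vanishes on every orbit.  The coordinates lie in
    K[a, b, c] because d/dx is [(f_y d_x - f_x d_y) / f_y] on the curve. *)

(** * Power series *)

Section PowerSeries.
Variable K : numFieldType.
Implicit Types (a : nat -> K) (s M v w h : K).

Definition dcoef a : nat -> K := fun n => a n.+1 *+ n.+1.

(** This bounds the second-order Taylor remainder of the power [n.+1] at [w]. The factor [s] on the
    left replaces an exponent [n - 1] on the right, so that n = 0 needs no special form. *)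
Lemma subrX_remainder s v w n : `|v| <= s -> `|w| <= s ->
  s * `|v ^+ n.+1 - w ^+ n.+1 - (v - w) * (w ^+ n *+ n.+1)|
    <= (n.+1 ^ 2)%:R * s ^+ n * `|v - w| ^+ 2.
Proof.
move=> vs ws; have s0 : 0 <= s := le_trans (normr_ge0 _) vs.
elim: n => [|n IH].
  rewrite !expr1 expr0 mulr1n mulr1 subrr normr0 mulr0.
  by rewrite !mulr_ge0 ?exprn_ge0.
(* Each remainder is [v] times the previous one plus a multiple of [(v - w) ^+ 2]; the constants
   then add up by (n+1)^2 + (n+1) <= (n+2)^2. *)
have -> : v ^+ n.+2 - w ^+ n.+2 - (v - w) * (w ^+ n.+1 *+ n.+2) =
    v * (v ^+ n.+1 - w ^+ n.+1 - (v - w) * (w ^+ n *+ n.+1))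
    + (v - w) ^+ 2 * w ^+ n * n.+1%:R.
  rewrite -(mulr_natr _ n.+2) -(mulr_natr _ n.+1) -[X in X%:R]addn1 natrD.
  rewrite !exprS expr0.
  by set V := v ^+ n; set W := w ^+ n; set N := n.+1%:R; ring.
apply: (@le_trans _ _ (s * ((n.+1 ^ 2)%:R * s ^+ n * `|v - w| ^+ 2)
    + s * (`|v - w| ^+ 2 * s ^+ n * n.+1%:R))); last first.
  rewrite [X in X <= _](_ : _ =
      (n.+1 ^ 2 + n.+1)%:R * s ^+ n.+1 * `|v - w| ^+ 2); last first.
    rewrite natrD (exprS s); set A := `|_|; set B := s ^+ n; set D := n.+1%:R.
    by set E := (_ ^ _)%:R; ring.
  rewrite ler_wpM2r ?exprn_ge0// ler_wpM2r ?exprn_ge0// ler_nat.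
  by rewrite addnC -mulnn -mulnS leq_mul.
rewrite -mulrDr ler_wpM2l//.
apply: le_trans (ler_normD _ _) _; rewrite lerD//.
  rewrite normrM; apply: le_trans IH; exact: ler_wpM2r.
rewrite !normrM !normrX normr_nat ler_wpM2r// ler_wpM2l ?exprn_ge0//.
by rewrite lerXn2r ?nnegrE.
Qed.

(** The order of [K] is only partial; [B] is nonnegative because it bounds a norm, hence comparable
    with the norm of [l], and a contradiction argument applies. *)
Lemma norm_cvgn_le (V : normedModType K) (u : nat -> V) (l : V) (B : K) :
  u @ \oo --> l -> (forall n, `|u n| <= B) -> `|l| <= B.
Proof.
move=> ul uB; rewrite real_leNgt ?ger0_real ?(le_trans _ (uB 0))//.
apply/negP => /(cvgr_norm_gt _ ul)[N _ /(_ N (leqnn N))] /=.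
by move=> /lt_le_trans/(_ (uB N)); rewrite ltxx.
Qed.

Lemma cvg_series_bounded (u : nat -> K^o) :
  cvgn (series u) -> exists2 M : K, 0 < M & forall n, `|u n| <= M.
Proof.
move=> /cvg_series_cvg_0/cvgr0Pnorm_lt/(_ 1 ltr01)[N _ uN].
exists (1 + \sum_(i < N) `|u i|); first by rewrite ltr_pwDl// sumr_ge0.
move=> n; have [nN|Nn] := ltnP n N.
  rewrite (bigD1 (Ordinal nN))//= addrCA lerDl addr_ge0// sumr_ge0//.
by rewrite (le_trans (ltW (uN n Nn)))// lerDl sumr_ge0.
Qed.

(* The radius of convergence is at least 8 s: since n^2 <= 4^n, the terms of the
   twice differentiated series at radius s are dominated by M / 2^n. *)
Lemma coef_bound a s M n : 0 < s -> (forall n, `|a n * (8 * s) ^+ n| <= M) ->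
  (n ^ 2)%:R * `|a n| * s ^+ n <= M * 2^-1 ^+ n.
Proof.
move=> s0 /(_ n); rewrite exprVn ler_pdivlMr ?exprn_gt0//; apply: le_trans.
rewrite normrM normrX normrM (gtr0_norm s0) normr_nat exprMn.
rewrite (_ : _ * _ * _ * _ = (n ^ 2 * 2 ^ n)%:R * (`|a n| * s ^+ n)); last first.
  by rewrite natrM (natrX _ 2 n); set A := (_ ^ _)%:R; ring.
rewrite [leRHS]mulrCA -natrX ler_wpM2r ?mulr_ge0 ?exprn_ge0 ?(ltW s0)// ler_nat.
rewrite (_ : 8 = 2 ^ 2 * 2)%N// expnMn leq_mul2r -expnM mulnC expnM.
by rewrite leq_exp2r// ltnW ?orbT// ltn_expl.
Qed.

(** The bound is that of the coefficient of index [n.+1], with [n.+1] below its square; the power of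
    [w] is one lower, whence the division by [s]. *)
Lemma dcoef_bound a s M w n : 0 < s -> (forall n, `|a n * (8 * s) ^+ n| <= M) ->
  `|w| <= s -> `|dcoef a n * w ^+ n| <= M / s * 2^-1 ^+ n.+1.
Proof.
move=> s0 aM ws; rewrite mulrAC ler_pdivlMr//.
apply: le_trans (coef_bound n.+1 s0 aM).
rewrite normrM normrMn normrX -(mulr_natl _ n.+1) exprSr mulrA ler_wpM2r ?(ltW s0)//.
apply: ler_pM; rewrite ?exprn_ge0// ?mulr_ge0//.
  by rewrite ler_wpM2r// ler_nat leq_pmulr.
by rewrite lerXn2r ?nnegrE// ltW.
Qed.

Lemma sum_half_le1 N : \sum_(0 <= n < N) 2^-1 ^+ n.+1 <= 1 :> K.
Proof.
suff -> : \sum_(0 <= n < N) 2^-1 ^+ n.+1 = 1 - 2^-1 ^+ N :> K.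
  by rewrite lerBlDr lerDl exprn_ge0.
elim: N => [|N IH]; first by rewrite big_geq// expr0 subrr.
by rewrite big_nat_recr//= IH exprS; field.
Qed.

(** The remainders of the monomials are summed with weights [a n.+1]. The coefficient bound
    dominates them by a geometric series of total at most 1, so the estimate stays quadratic in
    [v - w]. *)
Lemma termwise_remainder a s M v w (gv gw d : K^o) :
  0 < s -> (forall n, `|a n * (8 * s) ^+ n| <= M) -> `|v| <= s -> `|w| <= s ->
  series (fun n => a n * v ^+ n : K^o) @ \oo --> gv ->
  series (fun n => a n * w ^+ n : K^o) @ \oo --> gw ->
  series (fun n => dcoef a n * w ^+ n : K^o) @ \oo --> d ->
  `|gv - gw - (v - w) * d| <= M / s ^+ 2 * `|v - w| ^+ 2.
Proof.
move=> s0 aM vs ws cv cw cd; have M0 : 0 <= M := le_trans (normr_ge0 _) (aM 0).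
pose T n := v ^+ n.+1 - w ^+ n.+1 - (v - w) * (w ^+ n *+ n.+1).
have cT : (fun N => \sum_(0 <= n < N) a n.+1 * T n : K^o) @ \oo -->
    gv - gw - (v - w) * d.
  (* The constant terms at [v] and [w] cancel, so [N] remainders match [N.+1] terms of the two
     series and [N] terms of the derived one. *)
  rewrite (_ : (fun _ => _) = fun N =>
     series (fun n => a n * v ^+ n : K^o) N.+1
     - series (fun n => a n * w ^+ n : K^o) N.+1
     - (v - w) * series (fun n => dcoef a n * w ^+ n : K^o) N).
    apply: cvgB; first by apply: cvgB; rewrite (cvg_shiftS (series _)).
    by apply: cvgM => //; exact: cvg_cst.
  apply/funext => N; rewrite /series/= !big_nat_recl//= mulr_sumr.
  rewrite opprD addrACA expr0 subrr add0r -!sumrB; apply: eq_bigr => n _.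
  rewrite /T /dcoef -(mulr_natr (a n.+1)) -(mulr_natr (w ^+ n)).
  set m := n.+1%:R; ring.
apply: (norm_cvgn_le cT) => N; apply: le_trans (ler_norm_sum _ _ _) _.
apply: (@le_trans _ _ (\sum_(0 <= n < N)
   M / s ^+ 2 * `|v - w| ^+ 2 * 2^-1 ^+ n.+1)).
  apply: ler_sum => n _; rewrite normrM.
  have := ler_wpM2l (normr_ge0 (a n.+1)) (subrX_remainder n vs ws).
  rewrite -/(T n) mulrCA -ler_pdivlMl// => /le_trans; apply.
  have /(ler_wpM2r (divr_ge0 (exprn_ge0 2 (normr_ge0 (v - w)))
    (exprn_ge0 2 (ltW s0)))) := coef_bound n.+1 s0 aM.
  have sN0 : s != 0 by rewrite gt_eqF.
  set A := (_ ^ _)%:R; set B := 2^-1 ^+ n.+1 => le1.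
  rewrite (_ : _ * B = M * B * (`|v - w| ^+ 2 / s ^+ 2)); last by field.
  apply: le_trans le1; rewrite le_eqVlt; apply/orP; left; apply/eqP.
  by rewrite (exprS s n); field.
rewrite -mulr_sumr ler_piMr ?sum_half_le1// mulr_ge0 ?divr_ge0 ?exprn_ge0//.
exact: ltW.
Qed.

Lemma is_derive_pseries a (c r : K) (G D : K^o -> K^o) M : 0 < r ->
  (forall n, `|a n * (8 * r) ^+ n| <= M) ->
  (forall z, `|z - c| < r ->
     series (fun n => a n * (z - c) ^+ n : K^o) @ \oo --> G z) ->
  (forall z, `|z - c| < r ->
     series (fun n => dcoef a n * (z - c) ^+ n : K^o) @ \oo --> D z) ->
  forall z : K^o, `|z - c| < r -> is_derive z (1 : K^o) G (D z).
Proof.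
move=> r0 aM GE DE z zr.
suff H : h^-1 *: (G (h *: (1 : K^o) + z) - G z) @[h --> 0^'] --> D z.
  by apply: DeriveDef; [apply/cvg_ex; exists (D z)|exact/cvg_lim].
have M0 : 0 <= M := le_trans (normr_ge0 _) (aM 0).
apply/cvgrPdistC_le => e e0.
(* The summand 1 keeps the divisor of [e] positive even if [M] is 0. *)
have M1 : 0 < M / r ^+ 2 + 1.
  by rewrite ltr_wpDl// divr_ge0// exprn_ge0// ltW.
have e1 : 0 < e / (M / r ^+ 2 + 1) by rewrite divr_gt0.
near=> h.
have h0 : h != 0 by near: h; exact: nbhs_dnbhs_neq.
have hzr : `|h *: (1 : K^o) + z - c| < r.
  rewrite /GRing.scale /= mulr1 -addrA (le_lt_trans (ler_normD _ _))// -ltrBrDr.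
  by near: h; apply: dnbhs0_lt; rewrite subr_gt0.
have := termwise_remainder r0 aM (ltW hzr) (ltW zr) (GE _ hzr) (GE _ zr) (DE _ zr).
have -> : h *: (1 : K^o) + z - c - (z - c) = h.
  by rewrite /GRing.scale /= mulr1; ring.
move=> le1; rewrite -(@ler_pM2l _ `|h|) ?normr_gt0// -normrM mulrBr.
rewrite {1}/GRing.scale /= mulVKf// (le_trans le1)// expr2 mulrCA ler_wpM2l//.
rewrite (@le_trans _ _ ((M / r ^+ 2 + 1) * `|h|))//.
  by rewrite ler_wpM2r// lerDl.
rewrite mulrC -ler_pdivlMr//.
by apply: ltW; near: h; exact: dnbhs0_lt.
Unshelve. all: by end_near. Qed.

End PowerSeries.

(** * Term-by-term differentiation of complex power series *)

Section ComplexPowerSeries.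
Variable R : realType.
Local Notation C := (R[i]^o).
Implicit Types (a : nat -> C) (G : C -> C) (c z : C).

Lemma cvg_real_complex (u : nat -> R) (l : R) :
  u @ \oo --> l -> (fun n => (u n)%:C : C) @ \oo --> (l%:C : C).
Proof.
move=> ul; apply/cvgrPdist_lt => e e0.
have e0' : 0 < complex.Re e by move: e0; rewrite ltcE => /andP[].
move/cvgrPdist_lt : ul => /(_ _ e0'); apply: filterS => n un.
have er : (complex.Re e)%:C = e by rewrite RRe_real// gtr0_real.
rewrite -er -rmorphB/= normc_def/= expr0n/= addr0 sqrtr_sqr.
by rewrite ltcR.
Qed.

Lemma Re_series (b : nat -> C) n :
  complex.Re (series b n) = series (fun k => complex.Re (b k)) n.
Proof.
rewrite /series/=; elim: n => [|n IH]; first by rewrite !big_geq.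
by rewrite !big_nat_recr//= -IH; case: (\sum_(0 <= i < n) b i); case: (b n).
Qed.

Lemma Im_series (b : nat -> C) n :
  complex.Im (series b n) = series (fun k => complex.Im (b k)) n.
Proof.
rewrite /series/=; elim: n => [|n IH]; first by rewrite !big_geq.
by rewrite !big_nat_recr//= -IH; case: (\sum_(0 <= i < n) b i); case: (b n).
Qed.

(** The real and imaginary parts are at most the modulus in absolute value, so both series converge
    by comparison with a real geometric series. *)
Lemma cvg_series_geometric_le (b : nat -> C) (B : R[i]) :
  (forall n, `|b n| <= B * 2^-1 ^+ n.+1) -> cvgn (series b).
Proof.
move=> bB.
have B0 : 0 <= B.
  have := le_trans (normr_ge0 _) (bB 0%N).
  by rewrite expr1 pmulr_lge0// invr_gt0.
(* A nonnegative complex number is real, which moves the bound to [R]. *)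
have rB : B = (complex.Re B)%:C by rewrite RRe_real// ger0_real.
have cvgr (u : nat -> R) :
    (forall n, (`|u n|%:C : R[i]) <= `|b n|) -> cvgn (series u).
  move=> ub; apply: normed_cvg.
  apply: (@series_le_cvg _ _ (geometric (complex.Re B / 2) 2^-1)).
  - by move=> n /=.
  - by move=> n /=; rewrite mulr_ge0// divr_ge0// -ler0c -rB.
  - move=> n /=; rewrite -lecR; apply: le_trans (ub n) _.
    apply: le_trans (bB n) _.
    by rewrite rmorphM rmorphM/= -rB fmorphV rmorphXn/= fmorphV/= rmorph_nat exprS mulrA.
  - by apply: is_cvg_geometric_series; rewrite ger0_norm// invf_lt1// ltr1n.
have /cvgr cRe n : (`|complex.Re (b n)|%:C : R[i]) <= `|b n|.
  rewrite normc_def lecR -sqrtr_sqr ler_wsqrtr// lerDl sqr_ge0//.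
have /cvgr cIm n : (`|complex.Im (b n)|%:C : R[i]) <= `|b n|.
  rewrite normc_def lecR -sqrtr_sqr ler_wsqrtr// lerDr sqr_ge0//.
apply/cvg_ex; exists ((lim (series (fun k => complex.Re (b k)) @ \oo))%:C
  + 'i%C * (lim (series (fun k => complex.Im (b k)) @ \oo))%:C : C).
rewrite (_ : series b = fun n => (series (fun k => complex.Re (b k)) n)%:C
  + 'i%C * (series (fun k => complex.Im (b k)) n)%:C : C).
  apply: cvgD; first exact: cvg_real_complex.
  by apply: cvgM; [exact: cvg_cst|exact: cvg_real_complex].
by apply/funext => n; rewrite -Re_series -Im_series -complexE.
Qed.

(** This is the body of [holomorphic_at] with the coefficients named, so that they can be followed
    through differentiation. *)
Definition sums_to a c G : Prop :=
  \forall z \near c, series (fun n => a n * (z - c) ^+ n) @ \oo --> G z.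

Lemma sums_to_derive a c G : sums_to a c G ->
  (\forall z \near c, derivable G z (1 : C)) /\ sums_to (@dcoef R[i] a) c (derive1 G).
Proof.
move=> /nbhs_normP[r /= r0 aG].
have aG' z : `|z - c| < r -> series (fun n => a n * (z - c) ^+ n) @ \oo --> G z.
  by move=> zr; apply: aG; rewrite /= distrC.
(* Since 8 s = r / 2, the point [c + 8 * s] lies inside the disc of convergence; convergence there
   bounds the terms [a n * (8 * s) ^+ n]. *)
pose s : R[i] := r / 16.
have s0 : 0 < s by rewrite divr_gt0.
have rs : 8 * s = r / 2 by rewrite /s; field.
have [M M0 aM] : exists2 M : R[i], 0 < M & forall n, `|a n * (8 * s) ^+ n| <= M.
  apply: cvg_series_bounded; apply/cvg_ex; exists (G (c + 8 * s)).
  have := aG' (c + 8 * s); rewrite addrC addKr; apply.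
  by rewrite gtr0_norm ?mulr_gt0// rs ltr_pdivrMr// ltr_pMr// ltr1n.
have sr : s < r.
  by rewrite /s ltr_pdivrMr// ltr_pMr// ltr1n.
have GE z : `|z - c| < s -> series (fun n => a n * (z - c) ^+ n) @ \oo --> G z.
  by move=> zs; apply: aG'; rewrite (lt_trans zs).
pose D z : C := lim (series (fun n => @dcoef R[i] a n * (z - c) ^+ n : C) @ \oo).
have DE z : `|z - c| < s ->
    series (fun n => @dcoef R[i] a n * (z - c) ^+ n : C) @ \oo --> D z.
  move=> zs; apply: (@cvg_series_geometric_le _ (M / s)) => n.
  exact: (dcoef_bound n s0 aM (ltW zs)).
have GD := is_derive_pseries s0 aM GE DE.
have nearc : \forall z \near c, `|z - c| < s.
  by apply/nbhs_normP; exists s => //= z; rewrite /ball_/= distrC.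
split; apply: filterS nearc => z zs.
  by have [] := GD _ zs.
by rewrite derive1E; have [_ ->] := GD _ zs; exact: DE.
Qed.

End ComplexPowerSeries.

(** * Derivatives and changes of coordinate *)

Section Derive1.
Variable K : numFieldType.
Local Notation C := (K^o).
Implicit Types (f g : C -> C) (x df dg : C).

Lemma derive1_near f g x :
  (\forall t \near x, f t = g t) -> \forall t \near x, derive1 f t = derive1 g t.
Proof.
move/near_join; apply: filterS => t fg.
by rewrite !derive1E; exact: near_eq_derive.
Qed.

Lemma is_derive_derive1 f x : derivable f x (1 : C) ->
  is_derive x (1 : C) f (derive1 f x).
Proof. by rewrite derive1E; exact: derivableP. Qed.

Lemma is_derive_derive1E f x df : is_derive x (1 : C) f df -> derive1 f x = df.
Proof. by rewrite derive1E => -[]. Qed.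

Lemma is_derive_continuous f x df :
  is_derive x (1 : C) f df -> {for x, continuous f}.
Proof. by case=> /derivable1_diffP/differentiable_continuous. Qed.

Lemma is_derive_mul f g x df dg :
  is_derive x (1 : C) f df -> is_derive x (1 : C) g dg ->
  is_derive x (1 : C) (fun t => f t * g t) (df * g x + f x * dg).
Proof.
move=> fd gd; rewrite addrC (mulrC df).
exact: (@is_deriveM K C f g x 1 df dg fd gd).
Qed.

Lemma is_derive_add f g x df dg :
  is_derive x (1 : C) f df -> is_derive x (1 : C) g dg ->
  is_derive x (1 : C) (fun t => f t + g t) (df + dg).
Proof. exact: is_deriveD. Qed.

Lemma is_derive_inv g x dg : g x != 0 -> is_derive x (1 : C) g dg ->
  is_derive x (1 : C) (fun z => (g z)^-1) (- dg / g x ^+ 2).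
Proof.
move=> gx0 [dg1 <-]; apply: DeriveDef; first exact: derivableV.
by rewrite deriveV// /GRing.scale/= mulrC mulrN mulNr.
Qed.

Lemma is_derive_diff f x df : is_derive x (1 : C) f df ->
  forall v : C, 'd f x v = v * df.
Proof.
move=> [fd <-] v; have /derivable1_diffP fD := fd.
rewrite (@deriveE K C C f x 1 fD) -[v in LHS]mulr1 -[v * 1]/(v *: (1 : C)).
exact: linearZ.
Qed.

Lemma is_derive_compose f g x df dg :
  is_derive x (1 : C) f df -> is_derive (f x) (1 : C) g dg ->
  is_derive x (1 : C) (fun t => g (f t)) (dg * df).
Proof.
move=> f' g'; have [/derivable1_diffP fD _] := f'.
have [/derivable1_diffP gD _] := g'.
have cD : differentiable (g \o f) x by exact: differentiable_comp.
apply: DeriveDef; first exact/derivable1_diffP.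
rewrite (@deriveE K C C _ x 1 cD) (@diff_comp K C C C f g x fD gD) /=.
apply: etrans (is_derive_diff g' _) _; rewrite mulrC; congr (_ * _).
by apply: etrans (is_derive_diff f' _) _; rewrite mul1r.
Qed.

End Derive1.

Lemma near_continuous (T U : topologicalType) (f : T -> U) (x : T) (P : set U) :
  {for x, continuous f} -> (\forall y \near f x, P y) -> \forall t \near x, P (f t).
Proof. by move=> cf /cf. Qed.

(** * Effect of a change of coordinate on the coefficients of a differential *)

Section ChangeOfCoordinate.
Variable K : numFieldType.
Local Notation C := (K^o).

(** The relation [Hz = (Hw o G) G'] is differentiated twice by the product and chain rules. Whatever
    is differentiated again must be known near the point, not only at it. *)
Lemma derive1_change_coord (Hz Hw G : C -> C) (c : C) :
  (\forall t \near c, is_derive t (1 : C) G (derive1 G t)) ->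
  (\forall t \near c, is_derive t (1 : C) (derive1 G) (derive1 (derive1 G) t)) ->
  is_derive c (1 : C) (derive1 (derive1 G)) (derive1 (derive1 (derive1 G)) c) ->
  (\forall t \near G c, is_derive t (1 : C) Hw (derive1 Hw t)) ->
  is_derive (G c) (1 : C) (derive1 Hw) (derive1 (derive1 Hw) (G c)) ->
  (\forall t \near c, Hz t = Hw (G t) * derive1 G t) ->
  let G1 := derive1 G c in let G2 := derive1 (derive1 G) c in
  let G3 := derive1 (derive1 (derive1 G)) c in
  [/\ Hz c = Hw (G c) * G1,
      derive1 Hz c = derive1 Hw (G c) * G1 ^+ 2 + Hw (G c) * G2 &
      derive1 (derive1 Hz) c = derive1 (derive1 Hw) (G c) * G1 ^+ 3
        + 3 * (derive1 Hw (G c) * G1 * G2) + Hw (G c) * G3].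
Proof.
move=> dG dG1 dG2 dHw dH1 HzE G1 G2 G3.
have dGc := nbhs_singleton dG; have dG1c := nbhs_singleton dG1.
have dH := near_continuous (is_derive_continuous dGc) dHw.
have H1E : \forall t \near c, derive1 Hz t =
    derive1 Hw (G t) * derive1 G t * derive1 G t + Hw (G t) * derive1 (derive1 G) t.
  near=> t; rewrite (near (derive1_near HzE) t)//.
  apply: is_derive_derive1E; apply: is_derive_mul; last by near: t.
  by apply: is_derive_compose; near: t.
have dHG := is_derive_compose dGc (nbhs_singleton dHw).
have dH1G := is_derive_compose dGc dH1.
split; first exact: nbhs_singleton HzE.
  by rewrite (nbhs_singleton H1E) -mulrA -expr2.
rewrite (nbhs_singleton (derive1_near H1E)).
rewrite (is_derive_derive1E (is_derive_add
  (is_derive_mul (is_derive_mul dH1G dG1c) dG1c) (is_derive_mul dHG dG2))).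
rewrite -/G1 -/G2 -/G3.
move: (Hw _) (derive1 Hw _) (derive1 (derive1 Hw) _) G1 G2 G3 => h h1 h2 g1 g2 g3.
ring.
Unshelve. all: by end_near. Qed.

(** The right-hand sides are the rows of [Gmx g1 (g2 / 2) (g3 / 2)] applied to (U, V, W), in the
    shape produced by expanding the matrix product, zeros included. *)
Lemma Gmx_pullback (h h1 h2 g1 g2 g3 : K) :
  [/\ - (h * g1) = g1 * - h + (0 * - h1 + (0 * - (2^-1 * h2) + 0)),
      - (h1 * g1 ^+ 2 + h * g2) = 2 * (g2 / 2) * - h
        + (g1 ^+ 2 * - h1 + (0 * - (2^-1 * h2) + 0)) &
      - (2^-1 * (h2 * g1 ^+ 3 + 3 * (h1 * g1 * g2) + h * g3)) = g3 / 2 * - h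
        + (3 * g1 * (g2 / 2) * - h1 + (g1 ^+ 3 * - (2^-1 * h2) + 0))].
Proof. by split; field. Qed.

End ChangeOfCoordinate.

Section HolomorphicAt.
Variable R : realType.
Local Notation C := (R[i]^o).
Implicit Types (G H : C -> C) (c : C).

Lemma holomorphic_near_eq G H c : (\forall z \near c, G z = H z) ->
  holomorphic_at G c -> holomorphic_at H c.
Proof. by move=> GH [a aG]; exists a; move: GH aG; apply: filterS2 => z ->. Qed.

Lemma holomorphic_is_derive G c : holomorphic_at G c ->
  \forall z \near c, is_derive z (1 : C) G (derive1 G z).
Proof.
move=> [a /sums_to_derive[+ _]]; apply: filterS => z.
exact: is_derive_derive1.
Qed.

Lemma holomorphic_derive1 G c : holomorphic_at G c -> holomorphic_at (derive1 G) c.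
Proof. by move=> [a /sums_to_derive[_ aG]]; exists (@dcoef R[i] a). Qed.

Lemma holomorphic_continuous G c : holomorphic_at G c -> {for c, continuous G}.
Proof.
by move=> /holomorphic_is_derive/nbhs_singleton; exact: is_derive_continuous.
Qed.

Lemma UVW_change_coord (g : nat) (Hz Hw : 'I_g -> C -> C) G c :
  holomorphic_at G c -> (forall i, holomorphic_at (Hw i) (G c)) ->
  (forall i, \forall t \near c, Hz i t = Hw i (G t) * derive1 G t) ->
  UVW Hz c = Gmx (derive1 G c) (derive1 (derive1 G) c / 2)
    (derive1 (derive1 (derive1 G)) c / 2) *m UVW Hw (G c).
Proof.
move=> hG hH HzE; apply/matrixP => j i; rewrite !mxE !big_ord_recl big_ord0 !mxE /=.
have hG1 := holomorphic_derive1 hG; have hG2 := holomorphic_derive1 hG1.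
have [E0 E1 E2] := derive1_change_coord (holomorphic_is_derive hG)
  (holomorphic_is_derive hG1) (nbhs_singleton (holomorphic_is_derive hG2))
  (holomorphic_is_derive (hH i))
  (nbhs_singleton (holomorphic_is_derive (holomorphic_derive1 (hH i)))) (HzE i).
have [I0 I1 I2] := Gmx_pullback (Hw i (G c)) (derive1 (Hw i) (G c))
  (derive1 (derive1 (Hw i)) (G c)) (derive1 G c) (derive1 (derive1 G) c)
  (derive1 (derive1 (derive1 G)) c).
case: j => [[|[|[|//]]] jlt] /=.
- rewrite E0; exact I0.
- rewrite E1; exact I1.
- exact (etrans (congr1 (fun w => - (2^-1 * w)) E2) I2).
Qed.

(** The new parameters are read off the first column of the product. *)
Lemma mul_Gmx (a b c a' b' c' : R[i]) : Gmx a b c *m Gmx a' b' c' =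
  Gmx (a * a') (b * a' + a ^+ 2 * b') (c * a' + 6 * a * b * b' + a ^+ 3 * c').
Proof.
apply/matrixP => i j; rewrite mxE !big_ord_recl big_ord0 !mxE.
by case: i j => [[|[|[|//]]] ilt] [[|[|[|//]]] jlt] /=; ring.
Qed.

End HolomorphicAt.

(** * Polynomials along the curve *)

(* [ev] over any numFieldType; locked, since unification would unfold it. *)
HB.lock Definition eval2 (K : numFieldType) (p : mpoly 2 rat) (s t : K^o) : K^o :=
  meval (fun k : 'I_2 => [:: s; t]`_k) (map_mpoly ratr p).

Section PlanePolynomials.
Variable K : numFieldType.
Local Notation C := (K^o).
Implicit Types (p q f : mpoly 2 rat) (u v : C -> C) (s t : C).

(** Sums and products, rather than monomials, are the induction steps, so that derivation and
    continuity rules apply directly. *)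
Lemma mpoly2_ind (P : mpoly 2 rat -> Prop) :
  (forall c, P (mpolyC 2 c)) -> (forall i : 'I_2, P (mpolyX rat (mnm1 i))) ->
  (forall p q, P p -> P q -> P (p + q)) -> (forall p q, P p -> P q -> P (p * q)) ->
  forall p, P p.
Proof.
move=> PC PX PD PM; apply: mpolyind => [|c m p _ _ Pp]; first by rewrite -(mpolyC0 2).
apply: PD => //; rewrite -mul_mpolyC; apply: (PM) => //; rewrite mpolyXE_id.
apply: big_ind => [|//|i _]; first by rewrite -mpolyC1.
by elim: (m i) => [|k IH]; rewrite ?expr0 -?mpolyC1// exprS; exact: PM.
Qed.

Lemma eval2D p q s t : eval2 (p + q) s t = eval2 p s t + eval2 q s t.
Proof. by rewrite !eval2.unlock rmorphD mevalD. Qed.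

Lemma eval2B p q s t : eval2 (p - q) s t = eval2 p s t - eval2 q s t.
Proof. by rewrite !eval2.unlock rmorphB mevalB. Qed.

Lemma eval2M p q s t : eval2 (p * q) s t = eval2 p s t * eval2 q s t.
Proof. by rewrite !eval2.unlock rmorphM mevalM. Qed.

Lemma eval2C (c : rat) s t : eval2 (mpolyC 2 c) s t = ratr c.
Proof. by rewrite !eval2.unlock map_mpolyC/= mevalC. Qed.

Lemma eval2X (i : 'I_2) s t : eval2 (mpolyX rat (mnm1 i)) s t = [:: s; t]`_i.
Proof. by rewrite !eval2.unlock map_mpolyX/= mevalXU. Qed.

Lemma eval2_mderivX (j i : 'I_2) s t :
  eval2 (mderiv j (mpolyX rat (mnm1 i))) s t = (i == j)%:R.
Proof.
rewrite mderivX -mul_mpolyC eval2M eval2C mnm1E.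
have [->|_] := eqVneq i j; last by rewrite rmorph0 mul0r.
rewrite rmorph1 mul1r (_ : mnm_sub _ _ = mnm0); last first.
  by apply/mnmP => k; rewrite mnmBE mnm0E subnn.
by rewrite !eval2.unlock mpolyX0 rmorph1 meval1.
Qed.

Lemma is_derive_eval2 p u v (t du dv : C) :
  is_derive t (1 : C) u du -> is_derive t (1 : C) v dv ->
  is_derive t (1 : C) (fun z => eval2 p (u z) (v z))
    (eval2 (dx p) (u t) (v t) * du + eval2 (dy p) (u t) (v t) * dv).
Proof.
move=> u' v'; elim/mpoly2_ind: p => [c|i|p q p' q'|p q p' q'].
- rewrite /dx /dy !mderivC !eval2C rmorph0 !mul0r addr0.
  by under eq_fun do rewrite eval2C; exact: is_derive_cst.
- rewrite /dx /dy !eval2_mderivX; under eq_fun do rewrite eval2X.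
  by case: i => [[|[|//]] ilt] /=; rewrite !(mul0r, mul1r, addr0, add0r).
- rewrite /dx /dy !mderivD !eval2D; under eq_fun do rewrite eval2D.
  rewrite !mulrDl addrACA; exact (is_derive_add p' q').
- rewrite /dx /dy !mderivM !eval2D !eval2M; under eq_fun do rewrite eval2M.
  have E (a b c e P Q : C) : (a * Q + P * c) * du + (b * Q + P * e) * dv =
      (a * du + b * dv) * Q + P * (c * du + e * dv) by ring.
  by rewrite E; exact (is_derive_mul p' q').
Qed.

Lemma continuous_eval2 p (T : topologicalType) (a b : T -> C) (x : T) :
  {for x, continuous a} -> {for x, continuous b} ->
  {for x, continuous (fun z => eval2 p (a z) (b z))}.
Proof.
have E (f g : T -> C) : f =1 g -> {for x, continuous g} -> {for x, continuous f}.
  by move=> /funext ->.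
move=> ca cb; elim/mpoly2_ind: p => [c|i|p q p' q'|p q p' q'].
- by apply: (E _ _ (fun z => eval2C _ _ _)); exact: cst_continuous.
- by apply: (E _ _ (fun z => eval2X _ _ _)); case: i => [[|[|//]] ilt].
- exact: (E _ _ (fun z => eval2D _ _ _ _) (continuousD p' q')).
- exact: (E _ _ (fun z => eval2M _ _ _ _) (continuousM p' q')).
Qed.

(** The function [g] is the divided difference of [p] in its second variable, built algebraically so
    that it also makes sense where [u] and [v] meet. *)
Lemma eval2_sub_factor p u v (t : C) :
  {for t, continuous u} -> {for t, continuous v} -> u t = v t ->
  exists g : C -> C,
    [/\ forall z, eval2 p z (u z) - eval2 p z (v z) = (u z - v z) * g z,
        {for t, continuous g} & g t = eval2 (dy p) t (v t)].
Proof.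
move=> cu cv uv.
elim/mpoly2_ind: p => [c|i|p q [g [gE cg gt]] [h [hE ch ht]]
  |p q [g [gE cg gt]] [h [hE ch ht]]].
- exists (fun=> 0); split=> [z||]; first by rewrite !eval2C subrr mulr0.
    exact: cst_continuous.
  by rewrite /dy mderivC eval2C raddf0.
- exists (fun=> (i == ord_max)%:R); split; last by rewrite /dy eval2_mderivX.
    by case: i => [[|[|//]] ilt] z; rewrite !eval2X/= ?mulr1// subrr mulr0.
  exact: cst_continuous.
- exists (fun z => g z + h z); split=> [z||].
  + by rewrite !eval2D mulrDr -gE -hE; ring.
  + exact: continuousD cg ch.
  + by rewrite /dy mderivD eval2D gt ht.
(* The witness comes from p(u) q(u) - p(v) q(v) = (p(u) - p(v)) q(u) + p(v) (q(u) - q(v)). *)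
- exists (fun z => g z * eval2 q z (u z) + eval2 p z (v z) * h z); split=> [z||].
  + by rewrite !eval2M mulrDr mulrA -gE mulrCA -hE; ring.
  + have idC : {for t, continuous (@id C)} by exact: cvg_id.
    apply: continuousD; apply: continuousM => //.
      exact: (continuous_eval2 idC cu).
    exact: (continuous_eval2 idC cv).
  + by rewrite /dy mderivM eval2D !eval2M gt ht uv.
Qed.

(** Uniqueness in the implicit function theorem: the difference of two roots times a factor nonzero
    near [t] is zero. *)
Lemma eval2_root_unique p u v (t : C) :
  {for t, continuous u} -> {for t, continuous v} -> u t = v t ->
  eval2 (dy p) t (v t) != 0 ->
  (\forall z \near t, eval2 p z (u z) = 0) -> (\forall z \near t, eval2 p z (v z) = 0) ->
  \forall z \near t, u z = v z.
Proof.
move=> cu cv uv py pu pv; have [g [gE cg gt]] := eval2_sub_factor p cu cv uv.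
have gN0 : \forall z \near t, g z != 0 by apply: (cvgr_neq0 _ cg); rewrite gt.
near=> z; apply/eqP; rewrite -subr_eq0.
have := gE z; rewrite (near pu z)// (near pv z)// subr0 => /esym/eqP.
by rewrite mulf_eq0 (negPf (near gN0 z _)) ?orbF.
Unshelve. all: by end_near. Qed.

(** On the vertical line through [s], the coefficient of degree [d] is the constant coefficient of
    y^d in [f], whatever [s] is. *)
Lemma eval2_section f d s : msize f = d.+1 ->
  mcoeff (mnm_muln (mnm1 ord_max) d) f != 0 ->
  exists2 P : {poly K}, P != 0 & forall t, P.[t] = eval2 f s t.
Proof.
Proof.
set md := mnm_muln _ d => fd fmd.
pose P : {poly K} := \sum_(m <- msupp f)
  (ratr (mcoeff m f) * (s : K) ^+ m ord0) *: 'X^(m ord_max).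
exists P => [|t]; last first.
  have eval20 : eval2 0 s t = 0 by rewrite -(mpolyC0 2) eval2C raddf0.
  rewrite horner_sum [in RHS](mpolyE f).
  rewrite (big_morph (fun p => eval2 p s t) (fun p q => eval2D p q s t) eval20).
  apply: eq_bigr => m _; rewrite hornerZ hornerXn -mul_mpolyC eval2M eval2C.
  rewrite eval2.unlock map_mpolyX mevalX !big_ord_recl big_ord0 mulr1 -mulrA.
  by congr (_ * (_ * _ ^+ m _)); apply: val_inj.
have mdd : md ord_max = d by rewrite mulmnE mnm1E eqxx mul1n.
have md0 : md ord0 = 0%N by rewrite mulmnE mnm1E.
suff PE : P`_d = ratr (mcoeff md f).
  by apply: contraNneq fmd => P0; move: PE; rewrite P0 coef0 => /esym/eqP;
    rewrite fmorph_eq0.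
have fs : md \in msupp f by rewrite mcoeff_msupp.
rewrite coef_sum (bigD1_seq md)//= big1_seq ?addr0 => [|m /andP[mmd ms]].
  by rewrite coefZ coefXn mdd eqxx md0 mulr1 mulr1.
(* Total degree at most [d] leaves no room for x in a monomial of y-degree [d], so such a monomial
   is [md]. *)
rewrite coefZ coefXn; case: eqP => [dm|_]; last by rewrite mulr0.
have := msize_mdeg_lt ms; rewrite fd mdegE !big_ord_recl big_ord0 addn0 ltnS.
have -> : lift ord0 ord0 = ord_max :> 'I_2 by apply: val_inj.
rewrite -dm -[leqRHS]add0n leq_add2r leqn0 => /eqP m0.
case/eqP: mmd; apply/mnmP => -[[|[|//]] ilt].
  by rewrite (_ : Ordinal ilt = ord0) ?m0 ?md0//; apply: val_inj.
by rewrite (_ : Ordinal ilt = ord_max) ?mdd//; apply: val_inj.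
Qed.
End PlanePolynomials.

(** * Derivatives of rational functions along a branch *)

Section CurveDerivation.
Variable f : mpoly 2 rat.
Implicit Types p q : mpoly 2 rat.

(* The derivation dy f * d/dx of the coordinate ring of the curve f = 0. *)
Definition curve_der p : mpoly 2 rat := dx p * dy f - dx f * dy p.

(** Together with [quot_den], this is the quotient rule for d/dx = [curve_der] / f_y: the derivative
    of p / q is again a quotient of polynomials, so the rule can be iterated. *)
Definition quot_num p q : mpoly 2 rat := curve_der p * q - p * curve_der q.
Definition quot_den q : mpoly 2 rat := q * q * dy f.

Variable K : numFieldType.
Local Notation C := (K^o).
Variables (y : C -> C) (t : C).
Hypothesis dY : \forall z \near t, is_derive z (1 : C) y (derive1 y z).
Hypothesis fy0 : \forall z \near t, eval2 f z (y z) = 0.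
Hypothesis fyN0 : eval2 (dy f) t (y t) != 0.

Lemma curve_near_continuous p : {for t, continuous (fun z => eval2 p z (y z))}.
Proof.
apply: continuous_eval2; first exact: cvg_id.
exact: is_derive_continuous (nbhs_singleton dY).
Qed.

Lemma curve_near_neq0 p : eval2 p t (y t) != 0 -> \forall z \near t, eval2 p z (y z) != 0.
Proof. by move=> p0; apply: (cvgr_neq0 _ (@curve_near_continuous p)). Qed.

Lemma curve_is_derive p : \forall z \near t, is_derive z (1 : C)
  (fun z => eval2 p z (y z)) (eval2 (curve_der p) z (y z) / eval2 (dy f) z (y z)).
Proof.
have fyN := curve_near_neq0 fyN0.
have D q z : is_derive z (1 : C) y (derive1 y z) -> is_derive z (1 : C)
    (fun z => eval2 q z (y z)) (eval2 (dx q) z (y z) + eval2 (dy q) z (y z) * derive1 y z).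
  by move=> dy1; have := is_derive_eval2 q (is_derive_id z (1 : C)) dy1; rewrite mulr1.
(* The relation f = 0 is needed near each nearby [z], since it is differentiated there to give f_y
   y' = - f_x. *)
move/near_join : fy0 => fy00; near=> z.
have Yz : is_derive z (1 : C) y (derive1 y z) by near: z.
have Nz : eval2 (dy f) z (y z) != 0 by near: z.
have fz : \forall w \near z, eval2 f w (y w) = 0 by near: z.
have fz0 : is_derive z (1 : C) (fun w => eval2 f w (y w)) 0.
  by apply: near_eq_is_derive (is_derive_cst (0 : C) z (1 : C)); apply: filterS fz => w ->.
have /esym := is_derive_derive1E (D f z Yz); rewrite (is_derive_derive1E fz0).
move/eqP; rewrite addrC addr_eq0 => /eqP fe.
have := D p z Yz; congr is_derive.
rewrite /curve_der eval2B !eval2M; apply: (mulIf Nz); rewrite mulfVK//.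
rewrite mulrDl -[X in _ + X]mulrA [derive1 y z * _]mulrC fe mulrN.
by rewrite [X in _ - X]mulrC.
Unshelve. all: by end_near. Qed.

Lemma curve_quot_derive1 p q : eval2 q t (y t) != 0 ->
  \forall z \near t, derive1 (fun z => eval2 p z (y z) / eval2 q z (y z)) z =
    eval2 (quot_num p q) z (y z) / eval2 (quot_den q) z (y z).
Proof.
move=> q0; have qN := curve_near_neq0 q0; have fyN := curve_near_neq0 fyN0.
have Dp := curve_is_derive p; have Dq := curve_is_derive q; near=> z.
have Nz : eval2 (dy f) z (y z) != 0 by near: z.
have qz : eval2 q z (y z) != 0 by near: z.
have pD : is_derive z (1 : C) (fun z => eval2 p z (y z))
    (eval2 (curve_der p) z (y z) / eval2 (dy f) z (y z)) by near: z.
have qD : is_derive z (1 : C) (fun z => eval2 q z (y z))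
    (eval2 (curve_der q) z (y z) / eval2 (dy f) z (y z)) by near: z.
rewrite (is_derive_derive1E (is_derive_mul pD (is_derive_inv qz qD))).
rewrite /quot_num /quot_den (eval2B (curve_der p * q)) !eval2M.
move: (eval2 (dy f) z _) (eval2 q z _) (eval2 p z _) (eval2 (curve_der p) z _)
  (eval2 (curve_der q) z _) Nz qz => F Q P P' Q' F0 Q0.
by field; rewrite F0 Q0.
Unshelve. all: by end_near. Qed.

Lemma eval2_quot_den q : eval2 q t (y t) != 0 -> eval2 (quot_den q) t (y t) != 0.
Proof. by move=> q0; rewrite /quot_den !eval2M !mulf_neq0. Qed.

Lemma curve_quot_derive1n2 p q : eval2 q t (y t) != 0 ->
  derive1 (derive1 (fun z => eval2 p z (y z) / eval2 q z (y z))) t =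
  eval2 (quot_num (quot_num p q) (quot_den q)) t (y t)
    / eval2 (quot_den (quot_den q)) t (y t).
Proof.
move=> q0; rewrite (nbhs_singleton (derive1_near (curve_quot_derive1 p q0))).
exact: nbhs_singleton (curve_quot_derive1 _ (eval2_quot_den q0)).
Qed.

End CurveDerivation.

(** * Coordinates in K[a, b, c] *)

Section Branches.
Variable R : realType.
Local Notation C := (R[i]^o).
Implicit Types (f p q : mpoly 2 rat) (x : C) (y : C -> C).

Lemma evE p (s t : R[i]) : ev p s t = eval2 (K := R[i]) p s t.
Proof. by rewrite eval2.unlock. Qed.

Lemma branch_is_derive f x y : branch f x y ->
  \forall z \near x, is_derive z (1 : C) y (derive1 y z).
Proof. by case=> /holomorphic_is_derive. Qed.

Lemma branch_root f x y : branch f x y ->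
  \forall z \near x, eval2 (K := R[i]) f z (y z) = 0.
Proof. by case=> _ + _; apply: filterS => z; rewrite evE. Qed.

Lemma branch_dy f x y : branch f x y -> eval2 (K := R[i]) (dy f) x (y x) != 0.
Proof. by case=> _ _; rewrite evE. Qed.

Lemma UVW_Hbranch (g : nat) f (h : 'I_g -> mpoly 2 rat) x y j i : branch f x y ->
  let p := h i in let q := dy f in
  let p1 := quot_num f p q in let q1 := quot_den f q in
  let p2 := quot_num f p1 q1 in let q2 := quot_den f q1 in
  [/\ ev q x (y x) != 0, ev q1 x (y x) != 0, ev q2 x (y x) != 0 &
  UVW (Hbranch f h y) x j i =
  nth 0 [:: - (ev p x (y x) / ev q x (y x));
            - (ev p1 x (y x) / ev q1 x (y x));
            - (2^-1 * (ev p2 x (y x) / ev q2 x (y x)))] j].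
Proof.
move=> br p q p1 q1 p2 q2.
have [[dY r0] q0] := (branch_is_derive br, branch_root br, branch_dy br).
have q10 := eval2_quot_den q0 q0; have q20 := eval2_quot_den q0 q10.
have HE : Hbranch f h y i =
      fun z => eval2 (K := R[i]) p z (y z) / eval2 (K := R[i]) q z (y z).
  by apply/funext => z; rewrite /Hbranch !evE.
split; rewrite ?evE//; rewrite mxE HE.
have E1 := nbhs_singleton (curve_quot_derive1 dY r0 q0 p q0).
have E2 := curve_quot_derive1n2 dY r0 q0 p q0.
case: j => [[|[|[|//]]] jlt] /=.
- by [].
- exact (congr1 -%R E1).
- exact (congr1 (fun w => - (2^-1 * w)) E2).
Qed.

End Branches.

Lemma evD (R : realType) p q (s t : R[i]) : ev (p + q) s t = ev p s t + ev q s t.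
Proof. by rewrite /ev rmorphD mevalD. Qed.

Lemma evN (R : realType) p (s t : R[i]) : ev (- p) s t = - ev p s t.
Proof. by rewrite /ev rmorphN mevalN. Qed.

Lemma evM (R : realType) p q (s t : R[i]) : ev (p * q) s t = ev p s t * ev q s t.
Proof. by rewrite /ev rmorphM mevalM. Qed.

Lemma evMn (R : realType) p n (s t : R[i]) : ev (p *+ n) s t = ev p s t *+ n.
Proof. by rewrite /ev rmorphMn mevalMn. Qed.

Lemma ev0 (R : realType) (s t : R[i]) : ev 0 s t = 0.
Proof. by rewrite /ev rmorph0 meval0. Qed.

Lemma ev1 (R : realType) (s t : R[i]) : ev 1 s t = 1.
Proof. by rewrite /ev rmorph1 meval1. Qed.

Opaque ev.

(** * Values of elements of the function field at a point of the curve *)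

Section Coordinates.
Variables (K : fieldType) (iota : {rmorphism mpoly 2 rat -> K}) (f : mpoly 2 rat).
Hypothesis K_frac : is_fraction_field iota f.
Variables (R : realType) (x y : R[i]).
Hypothesis fxy : ev f x y = 0.

(** The kernel of [iota] consists of multiples of [f], which vanish at the point. *)
Lemma ev_iota_neq0 q : ev q x y != 0 -> iota q != 0.
Proof.
apply: contraNneq => /(K_frac.1 q)[r ->].
by rewrite evM fxy mulr0.
Qed.

Lemma has_valueD k k' v v' : has_value iota x y k v -> has_value iota x y k' v' ->
  has_value iota x y (k + k') (v + v').
Proof.
move=> [p [q [-> q0 ->]]] [p' [q' [-> q'0 ->]]].
exists (p * q' + p' * q), (q * q'); split.
- rewrite (rmorphD iota) !(rmorphM iota) addf_div //.
    exact: ev_iota_neq0 q0.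
  exact: ev_iota_neq0 q'0.
- rewrite evM.
  exact (mulf_neq0 q0 q'0).
- rewrite evD !evM; exact (addf_div _ _ q0 q'0).
Qed.

Lemma has_value0 : has_value iota x y 0 0.
Proof.
exists 0, 1; split; first by rewrite rmorph0 mul0r.
  rewrite ev1; exact: oner_neq0.
by rewrite ev0 mul0r.
Qed.

(** One list of monomials and fractions gives the element of K[a, b, c] for [e = iota] and its
    specialization at a point when [e] is evaluation there. *)
Definition frac_mpoly (F : fieldType) (e : mpoly 2 rat -> F)
    (s : seq (multinom 3 * (mpoly 2 rat * mpoly 2 rat))) : mpoly 3 F :=
  \sum_(t <- s) (e t.2.1 / e t.2.2) *: mpolyX F t.1.

Lemma specializes_frac_mpoly s :
  all (fun t => ev t.2.2 x y != 0) s ->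
  specializes iota x y (frac_mpoly iota s) (frac_mpoly (fun p => ev p x y) s).
Proof.
move=> /allP s0 m; rewrite /frac_mpoly !raddf_sum /= big_seq [X in has_value _ _ _ _ X]big_seq.
apply: (big_ind2 (has_value iota x y)); first exact: has_value0.
  by move=> ? ? ? ?; exact: has_valueD.
move=> t ts; rewrite !mcoeffZ !mcoeffX; case: eqP => _; rewrite ?mulr1 ?mulr0.
  by exists t.2.1, t.2.2; split; rewrite ?s0.
exact: has_value0.
Qed.

End Coordinates.

(* The monomials in a, b, c of the j-th row of [Gmx a b c *m UVW], with the
   numerator and denominator of their coefficients. *)
Definition param_terms (f p : mpoly 2 rat) (j : 'I_3) :
    seq (multinom 3 * (mpoly 2 rat * mpoly 2 rat)) :=
  let q := dy f in
  let p1 := quot_num f p q in let q1 := quot_den f q in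
  let p2 := quot_num f p1 q1 in let q2 := quot_den f q1 in
  let a := mnm1 (inord 0) in let b := mnm1 (inord 1) in let c := mnm1 (inord 2) in
  nth [::] [:: [:: (a, (- p, q))];
               [:: (b, (- (p *+ 2), q)); (mnm_add a a, (- p1, q1))];
               [:: (c, (- p, q)); (mnm_add a b, (- (p1 *+ 3), q1));
                   (mnm_add a (mnm_add a a), (- p2, q2 *+ 2))]] j.

(** Signs and integer factors sit inside the numerators and denominators, so [e] has to respect only
    opposites and integer multiples. *)
Lemma meval_param_terms (F : numFieldType) (e : mpoly 2 rat -> F) f p j (a b c : F) :
  (forall r, e (- r) = - e r) -> (forall r n, e (r *+ n) = e r *+ n) ->
  let q := dy f in
  let p1 := quot_num f p q in let q1 := quot_den f q in
  let p2 := quot_num f p1 q1 in let q2 := quot_den f q1 in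
  let u := - (e p / e q) in let v := - (e p1 / e q1) in
  let w := - (2^-1 * (e p2 / e q2)) in
  meval (fun k : 'I_3 => [:: a; b; c]`_k) (frac_mpoly e (param_terms f p j)) =
  [:: a * u; 2 * b * u + a ^+ 2 * v; c * u + 3 * a * b * v + a ^+ 3 * w]`_j.
Proof.
move=> eN eMn q p1 q1 p2 q2 u v w.
pose m3 := (mevalZ, mevalX, big_ord_recl, big_ord0, mnmDE, mnm1E).
have i0 : (inord 0 : 'I_3) = ord0 by apply: val_inj; rewrite /= inordK.
have i1 : (inord 1 : 'I_3) = lift ord0 ord0 by apply: val_inj; rewrite /= inordK.
have i2 : (inord 2 : 'I_3) = lift ord0 (lift ord0 ord0) by apply: val_inj; rewrite /= inordK.
have E r s : e (- r) / e s = - (e r / e s) by rewrite eN mulNr.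
case: j => [[|[|[|//]]] jlt]; rewrite /frac_mpoly /param_terms /=
    ?big_cons big_nil ?mevalD meval0 addr0 !m3 i0 ?i1 ?i2 /= !E ?eMn;
  rewrite -/q -/p1 -/q1 -/p2 -/q2 /u /v /w.
- by move: (_ / _) => U; ring.
- by move: (e p) (e p1) (e q)^-1 (e q1)^-1 => P P1 Q Q1; ring.
(* The factor 1/2 of [w] is stored in the denominator [q2 *+ 2]. *)
- rewrite -(mulr_natr (e q2)) invfM.
  by move: (e p) (e p1) (e p2) (e q)^-1 (e q1)^-1 (e q2)^-1 => P P1 P2 Q Q1 Q2; field.
Qed.

Lemma Gmx_mulE (R : realType) (g : nat) (a b c : R[i]) (M : 'M[R[i]]_(3, g)) j i :
  let u := M ord0 i in let v := M (lift ord0 ord0) i in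
  let w := M (lift ord0 (lift ord0 ord0)) i in
  (Gmx a b c *m M) j i =
  [:: a * u; 2 * b * u + a ^+ 2 * v; c * u + 3 * a * b * v + a ^+ 3 * w]`_j.
Proof.
move=> u v w; rewrite mxE !big_ord_recl big_ord0 !mxE -/u -/v -/w.
by case: j => [[|[|[|//]]] jlt] /=; rewrite !(mul0r, addr0) ?addrA.
Qed.

Lemma mulr2n_neq0 (F : numFieldType) (u : F) : u != 0 -> u *+ 2 != 0.
Proof. by rewrite mulrn_eq0. Qed.

Lemma param_coordinates_in_Kabc (K : fieldType) (iota : {rmorphism mpoly 2 rat -> K})
  (R : realType) (g : nat) (f : mpoly 2 rat) (h : 'I_g -> mpoly 2 rat) :
  is_fraction_field iota f -> coordinates_in_Kabc iota R f h.
Proof.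
(* The witness depends on [f] and [h] alone, hence serves all branches at once. *)
move=> Kf; exists (fun j i => frac_mpoly iota (param_terms f (h i) j)).
move=> x y br j i.
have E k := UVW_Hbranch h k i br.
have /= [q0 q10 q20 _] := E ord0.
have fxy : ev f x (y x) = 0 by case: br => _ /nbhs_singleton.
exists (frac_mpoly (fun p => ev p x (y x)) (param_terms f (h i) j)).
  apply: (specializes_frac_mpoly Kf fxy).
  have q20' : ev (quot_den f (quot_den f (dy f)) *+ 2) x (y x) != 0.
    rewrite evMn; exact (mulr2n_neq0 q20).
  case: j => [[|[|[|//]]] jlt] /=.
  - exact (introT andP (conj q0 isT)).
  - exact (introT and3P (And3 q0 q10 isT)).
  - exact (introT and4P (And4 q0 q10 q20' isT)).
move=> a b c a0; rewrite meval_param_terms; last 2 first.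
- by move=> r; rewrite evN.
- by move=> r n; rewrite evMn.
rewrite /param Gmx_mulE.
have [_ _ _ ->] := E ord0.
have [_ _ _ ->] := E (lift ord0 ord0).
have [_ _ _ ->] := E (lift ord0 (lift ord0 ord0)).
by [].
Qed.

(** * Density *)

Section LocalFacts.
Variable K : numFieldType.
Local Notation C := (K^o).

Lemma cvg_series_head (u : nat -> C) (l : C) :
  (forall n, u n.+1 = 0) -> series u @ \oo --> l -> l = u 0%N.
Proof.
move=> u0 ul; have /cvg_unique : (fun=> u 0%N : C) @ \oo --> l; last first.
  by apply => //; exact: cvg_cst.
rewrite -(cvg_shiftS (series u)) in ul; apply: cvg_trans ul; apply: near_eq_cvg.
apply: nearW => n; by rewrite /series/= big_nat_recl// big1 ?addr0.
Qed.

(** If [O] were finite, removing the closed set [O] minus [c] would isolate [c], whereas punctured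
    neighbourhoods of [c] are nonempty. *)
Lemma open_infinite (O : set C) (c : C) : open O -> O c -> infinite_set O.
Proof.
move=> Oo Oc finO.
have fin : finite_set (O `\ c) by exact: finite_setD.
have /closed_openC opn : closed (O `\ c).
  exact: (accessible_finite_set_closed.1 (hausdorff_accessible (@norm_hausdorff K C))).
have near1 : \forall t \near c, t = c.
  have h1 : \forall t \near c, O t by exact: open_nbhs_nbhs.
  have h2 : \forall t \near c, (~` (O `\ c)) t.
    by apply: open_nbhs_nbhs; split => // -[_ /(_ erefl)].
  near=> t; apply: contrapT => tc.
  have : (~` (O `\ c)) t by near: t.
  by apply; split => //; near: t.
have h3 : \forall t \near c^', t = c by exact: cvg_within near1.
have h4 : \forall t \near c^', t != c by exact: nbhs_dnbhs_neq.
have [t [-> /eqP]] := filter_ex (filterI h3 h4); exact.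
Unshelve. all: by end_near. Qed.

Lemma near_root_poly0 (P : {poly K}) (c : C) :
  (\forall t \near c, P.[t] = 0) -> P = 0.
Proof.
move=> /nbhs_interior; rewrite /interior/= => Pc; apply/eqP/negPn/negP => P0.
pose O : set C := interior [set t : C | P.[t] = 0].
have infO : infinite_set O.
  apply: (@open_infinite O c); first exact: open_interior.
  exact: nbhs_singleton Pc.
have [B BO] := infinite_set_fset (size P) infO.
apply/negP; rewrite -ltnNge.
apply: (@max_poly_roots _ P (finmap.enum_fset B) P0 _ (finmap.fset_uniq B)).
by apply/allP => t /BO/interior_subset/= /rootP.
Qed.

Lemma eq_continuous_at (T : topologicalType) (f g : T -> C) (x : T) :
  f =1 g -> {for x, continuous g} -> {for x, continuous f}.
Proof. by move=> /funext ->. Qed.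

Lemma continuous_sum (T : topologicalType) (I : Type) (r : seq I)
    (v : I -> T -> C) (x : T) :
  (forall i, {for x, continuous (v i)}) ->
  {for x, continuous (fun z => \sum_(i <- r) v i z)}.
Proof.
move=> cv; elim: r => [|i r IH].
  by apply: (eq_continuous_at (fun z => big_nil _ _ _ _)); exact: cst_continuous.
apply: (eq_continuous_at (fun z => big_cons _ _ _ _ _ _)) => /=.
exact: continuousD (cv i) IH.
Qed.

Lemma continuous_prod (T : topologicalType) (I : Type) (r : seq I)
    (v : I -> T -> C) (x : T) :
  (forall i, {for x, continuous (v i)}) ->
  {for x, continuous (fun z => \prod_(i <- r) v i z)}.
Proof.
move=> cv; elim: r => [|i r IH].
  by apply: (eq_continuous_at (fun z => big_nil _ _ _ _)); exact: cst_continuous.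
apply: (eq_continuous_at (fun z => big_cons _ _ _ _ _ _)) => /=.
exact: continuousM (cv i) IH.
Qed.

Lemma continuous_expr (T : topologicalType) (v : T -> C) (x : T) n :
  {for x, continuous v} -> {for x, continuous (fun z => v z ^+ n)}.
Proof.
move=> cv; elim: n => [|n IH]; first exact: cst_continuous.
by apply: (eq_continuous_at (fun z => exprS _ _)); exact: continuousM cv IH.
Qed.

Lemma continuous_meval (T : topologicalType) n (F : mpoly n K)
    (v : 'I_n -> T -> C) (x : T) :
  (forall k, {for x, continuous (v k)}) ->
  {for x, continuous (fun z => meval (fun k => v k z) F : C)}.
Proof.
move=> cv; apply: (eq_continuous_at (fun z => mevalE _ _)).
apply: (@continuous_sum T _ _ (fun m z => mcoeff m F * \prod_i v i z ^+ m i)) => m.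
apply: (@continuousM _ _ (fun=> mcoeff m F : C)); first exact: cst_continuous.
by apply: continuous_prod => i; exact: continuous_expr.
Qed.

Lemma continuous_mulmx (T : topologicalType) m n k (A : 'M[K]_(m, n))
    (M : T -> 'M[K]_(n, k)) (x : T) :
  (forall i j, {for x, continuous (fun z => M z i j : C)}) ->
  forall i j, {for x, continuous (fun z => (A *m M z) i j : C)}.
Proof.
move=> cM i j; apply: (@eq_continuous_at _ _ (fun z => \sum_l A i l * M z l j)) => [z|].
  by rewrite mxE.
apply: continuous_sum => l.
by apply: (@continuousM _ _ (fun=> A i l : C)); first exact: cst_continuous.
Qed.

End LocalFacts.

(** * Holomorphic functions with zero derivative *)

Section HolomorphicConstant.
Variable R : realType.
Local Notation C := (R[i]^o).

Lemma sums_to_at a (G : C -> C) (c : C) : sums_to a c G -> G c = a 0%N.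
Proof.
move=> /nbhs_singleton aG.
have /= := cvg_series_head (K := R[i]) _ aG; rewrite expr0 mulr1; apply=> n.
by rewrite subrr expr0n mulr0.
Qed.

(** Induction passes to the derivative, which also vanishes near [c] and whose coefficient of index
    n is (n+1) times that of index n+1 of [G]. *)
Lemma sums_to_eq0 a (G : C -> C) (c : C) n : sums_to a c G ->
  (\forall z \near c, G z = 0) -> a n = 0.
Proof.
elim: n a G => [|n IH] a G aG G0.
  by rewrite -(sums_to_at aG); exact: nbhs_singleton G0.
have [_ daG] := sums_to_derive aG.
have : @dcoef R[i] a n = 0.
  apply: IH daG _; have := derive1_near (K := R[i]) (g := fun=> 0) G0.
  by apply: filterS => z ->; exact: derive1_cst.
by move/eqP; rewrite /dcoef mulrn_eq0 => /eqP.
Qed.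

Lemma holomorphic_derive1_eq0 (G : C -> C) (c : C) : holomorphic_at G c ->
  (\forall z \near c, derive1 G z = 0) -> \forall z \near c, G z = G c.
Proof.
move=> [a aG] G0; have [_ daG] := sums_to_derive aG.
have a0 n : a n.+1 = 0.
  have : @dcoef R[i] a n = 0 := sums_to_eq0 n daG G0.
  by move/eqP; rewrite /dcoef mulrn_eq0 => /eqP.
rewrite (sums_to_at aG); move: aG; apply: filterS => z aG.
have /= := cvg_series_head (K := R[i]) _ aG; rewrite expr0 mulr1; apply=> n.
by rewrite a0 mul0r.
Qed.

End HolomorphicConstant.

(** * Zeros of weighted homogeneous polynomials *)

Section WeightedProjective.
Variables (R : realType) (g : nat).
Implicit Types (F : @wpoly R g) (M : 'M[R[i]]_(3, g)).

Lemma weval_wscale F : whomogeneous F -> exists e, forall t M,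
  weval F (wscale t *m M) = t ^+ e * weval F M.
Proof.
move=> [e Fe]; exists e => t M; rewrite /weval !mevalE mulr_sumr.
apply: eq_big_seq => m mF; rewrite mulrCA; congr (_ * _).
rewrite -(Fe m mF) expr_sum -big_split; apply: eq_bigr => k _ /=.
by rewrite mul_diag_mx !mxE exprMn -exprM mulnC.
Qed.

(** Closed sets test vanishing on the chosen representative of a point; by homogeneity any other
    coordinates differ by a nonzero factor in the value. *)
Lemma weval_wcoords F P M : whomogeneous F -> wcoords P M ->
  (weval F (val (repr P)) == 0) = (weval F M == 0).
Proof.
move=> /weval_wscale[e Fe] [nz PE].
have : (\pi_(WP R g) (repr P) = \pi_(WP R g) (exist _ M nz))%qT by rewrite reprK.
move/eqquotP.
move=> /asboolP[t t0 /= ->]; rewrite Fe mulf_eq0.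
by rewrite expf_eq0 (negPf t0) andbF.
Qed.

End WeightedProjective.

(** By the chain rule H'(G t) G'(t) = 1. This makes the parameter [a] of a coordinate change
    nonzero. *)
Lemma derive1_invertible_neq0 (K : numFieldType) (G H : K^o -> K^o) (t : K^o) :
  is_derive t (1 : K^o) G (derive1 G t) ->
  is_derive (G t) (1 : K^o) H (derive1 H (G t)) ->
  (\forall z \near t, H (G z) = z) -> derive1 G t != 0.
Proof.
move=> dG dH HG; have := is_derive_derive1E (is_derive_compose dG dH).
rewrite (nbhs_singleton (derive1_near HG)) (is_derive_derive1E (is_derive_id t (1 : K^o))).
by move=> e; apply/eqP => G0; move/eqP: e; rewrite G0 mulr0 oner_eq0.
Qed.

(** One direction is continuity of the chart, the other its openness. Local statements thus pass
    between the surface and the complex plane. *)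
Lemma near_chart (R : realType) (T : topologicalType) (V : set T) (z : T -> R[i]^o)
    (p : T) (P : set R[i]^o) : is_chart V z -> V p ->
  (\forall t \near z p, P t) <-> (\forall q \near p, P (z q)).
Proof.
move=> [Vo _ cz oz] Vp; split; first exact: near_continuous (cz p Vp).
move=> Pq; pose W := V `&` interior [set q | P (z q)].
have : open (z @` W).
  by apply: oz; [apply: openI => //; exact: open_interior|by move=> q []].
move=> zWo; have : nbhs (z p) (z @` W).
  by apply: open_nbhs_nbhs; split => //; exists p => //; split.
by apply: filterS => _ [q [_ /interior_subset Pq'] <-].
Qed.

(** * Comparison of local coordinates on a Riemann surface *)

Section RiemannSurface.
Variables (R : realType) (X : riemann_surface R).
Local Notation C := (R[i]^o).
Implicit Types (p q : X) (z w : X -> C).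

Lemma local_coordinateP p z (P : set C) : local_coordinate p z ->
  (\forall t \near z p, P t) <-> (\forall q \near p, P (z q)).
Proof. by move=> [V [Vp Vz _]]; exact (near_chart P Vz Vp). Qed.

Lemma local_coordinate_near p z : local_coordinate p z ->
  \forall q \near p, local_coordinate q z.
Proof.
move=> [V [Vp Vz Vc]]; have [Vo _ _ _] := Vz.
by apply: filterS (open_nbhs_nbhs (conj Vo Vp)) => q Vq; exists V.
Qed.

Lemma atlas_local_coordinate U phi p : @rs_atlas R X (U, phi) -> U p ->
  local_coordinate p phi.
Proof.
move=> Uphi Up; exists U; split => // [|V psi q Vpsi Vq Uq].
  exact: rs_chart Uphi.
by split; [exact: (rs_compat Vpsi Uphi Vq Uq)|exact: (rs_compat Uphi Vpsi Uq Vq)].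
Qed.

(* The transition function is known to be holomorphic only at [z p], whence the
   hypothesis on the points near p. *)
Lemma UVW_transition (g : nat) (omega : 'I_g -> differential X) p z w
    (Hz Hw : 'I_g -> C -> C) :
  (forall i, holomorphic_differential (omega i)) ->
  local_coordinate p z -> local_coordinate p w ->
  (\forall q \near p, holomorphic_wrt z w q) -> holomorphic_wrt w z p ->
  (forall i, \forall q \near p, omega i q z = Hz i (z q)) ->
  (forall i, \forall q \near p, omega i q w = Hw i (w q)) ->
  exists a b c, a != 0 /\ UVW Hz (z p) = Gmx a b c *m UVW Hw (w p).
Proof.
move=> hom lz lw zw [Gi hGi zE] HzE HwE; have [G hG wE] := nbhs_singleton zw.
have wp : w p = G (z p) := nbhs_singleton wE.
(* [Hw i] is only assumed to express [omega i]; near [w p] it agrees with the holomorphic function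
   supplied by the definition of a holomorphic differential. *)
have hHw i : holomorphic_at (Hw i) (G (z p)).
  rewrite -wp; have [_ /(_ p w lw)[H hH HE]] := hom i.
  apply: holomorphic_near_eq hH; apply/(local_coordinateP _ lw).
  near=> q; have <- : omega i q w = H (w q) by near: q.
  by near: q; exact: HwE.
have HzG i : \forall t \near z p, Hz i t = Hw i (G t) * derive1 G t.
  apply/(local_coordinateP _ lz).
  have wE2 := near_join wE; near=> q.
  have lzq : local_coordinate q z by near: q; exact: local_coordinate_near.
  have lwq : local_coordinate q w by near: q; exact: local_coordinate_near.
  have wEq : \forall r \near q, w r = G (z r) by near: q; exact: wE2.
  have [Gq hGq wGq] : holomorphic_wrt z w q by near: q.
  have <- : omega i q z = Hz i (z q) by near: q; exact: HzE.
  have HwEq : omega i q w = Hw i (w q) by near: q; exact: HwE.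
  rewrite -(nbhs_singleton wEq) -HwEq.
  have [/(_ q z w Gq lzq lwq hGq wGq) -> _] := hom i.
  (* The transformation rule at [q] uses the transition function [Gq] found at [q]; it has the germ
     of [G], hence the same derivative. *)
  have GE : \forall t \near z q, Gq t = G t.
    apply/(local_coordinateP _ lzq); near=> r.
    have <- : w r = G (z r) by near: r.
    by have <- : w r = Gq (z r) by near: r.
  exact (congr1 (fun v => omega i q w * v)
    (nbhs_singleton (derive1_near (K := R[i]) GE))).
exists (derive1 G (z p)), (derive1 (derive1 G) (z p) / 2),
  (derive1 (derive1 (derive1 G)) (z p) / 2); split; last first.
  by rewrite wp; exact: UVW_change_coord.
rewrite wp in hGi; apply: (derive1_invertible_neq0 (K := R[i])).
- exact: nbhs_singleton (holomorphic_is_derive hG).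
- exact: nbhs_singleton (holomorphic_is_derive hGi).
apply/(local_coordinateP _ lz); near=> q.
have <- : w q = G (z q) by near: q.
by have <- : z q = Gi (w q) by near: q.
Unshelve. all: by end_near. Qed.

(** Local coordinates are compatible with atlas charts by definition, so the comparison goes through
    a chart [phi] and the two group elements are multiplied. *)
Lemma UVW_local_coordinates (g : nat) (omega : 'I_g -> differential X) p z w
    (Hz Hw : 'I_g -> C -> C) :
  (forall i, holomorphic_differential (omega i)) ->
  local_coordinate p z -> local_coordinate p w ->
  (forall i, \forall q \near p, omega i q z = Hz i (z q)) ->
  (forall i, \forall q \near p, omega i q w = Hw i (w q)) ->
  exists a b c, a != 0 /\ UVW Hz (z p) = Gmx a b c *m UVW Hw (w p).
Proof.
move=> hom lz lw HzE HwE; have [U [phi [Uphi Up]]] := rs_cover p.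
have lphi := atlas_local_coordinate Uphi Up.
have [Uo _ _ _] := rs_chart Uphi.
have nU : \forall q \near p, U q := open_nbhs_nbhs (conj Uo Up).
have wrt_phi v : local_coordinate p v -> \forall q \near p,
    holomorphic_wrt phi v q /\ holomorphic_wrt v phi q.
  move=> [V [Vp [Vo _ _ _] Vc]]; have nV := open_nbhs_nbhs (conj Vo Vp).
  by move: nU nV; apply: filterS2 => q Uq Vq; exact: Vc Uphi Uq Vq.
have /choice[Hphi HphiE] i :
    exists H : C -> C, \forall q \near p, omega i q phi = H (phi q).
  by have [_ /(_ p phi lphi)[H _ HE]] := hom i; exists H.
have z_phi := wrt_phi z lz; have w_phi := wrt_phi w lw.
have [a [b [c [a0 ->]]]] := UVW_transition hom lz lphi
  (filterS (fun q => @proj2 _ _) z_phi) (proj1 (nbhs_singleton z_phi)) HzE HphiE.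
have [a' [b' [c' [a'0 ->]]]] := UVW_transition hom lphi lw
  (filterS (fun q => @proj1 _ _) w_phi) (proj2 (nbhs_singleton w_phi)) HphiE HwE.
rewrite mulmxA mul_Gmx; do 3 eexists; split; last by [].
exact (mulf_neq0 a0 a'0).
Qed.

End RiemannSurface.

(** Here y is the coordinate and x = G(y): differentiating f(G(y), y) = 0 gives f_x G' + f_y = 0. *)
Lemma root_derive1_eq0 (K : numFieldType) (f : mpoly 2 rat) (G : K^o -> K^o) (t : K^o) :
  (\forall z \near t, is_derive z (1 : K^o) G (derive1 G z)) ->
  (\forall z \near t, eval2 f (G z) z = 0) ->
  (\forall z \near t, eval2 (dy f) (G z) z = 0) ->
  eval2 (dx f) (G t) t != 0 ->
  \forall z \near t, derive1 G z = 0.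
Proof.
move=> dG f0 fy0 fx.
have fxN : \forall z \near t, eval2 (dx f) (G z) z != 0.
  have cf : {for t, continuous (fun z => eval2 (dx f) (G z) z)}.
    apply: continuous_eval2; last exact: cvg_id.
    exact: is_derive_continuous (nbhs_singleton dG).
  by apply: (cvgr_neq0 _ cf).
move/near_join : f0 => f0; near=> z.
have Gz : is_derive z (1 : K^o) G (derive1 G z) by near: z.
have fz : \forall w \near z, eval2 f (G w) w = 0 by near: z.
have Nz : eval2 (dx f) (G z) z != 0 by near: z.
have Dz := is_derive_derive1E (is_derive_eval2 f Gz (is_derive_id z (1 : K^o))).
move: Dz; rewrite (nbhs_singleton (derive1_near fz)) derive1_cst.
rewrite (_ : eval2 (dy f) _ _ = 0) ?mul0r ?addr0; last by near: z.
by move=> /esym/eqP; rewrite mulf_eq0 (negPf Nz) => /eqP.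
Unshelve. all: by end_near. Qed.

(** * Nonvanishing near a point by continuity *)

Section Continuity.
Variables (R : realType) (g : nat).
Local Notation C := (R[i]^o).

Lemma continuous_Gmx_UVW (H : 'I_g -> C -> C) (t : C) (a b c : R[i]) :
  (forall i, holomorphic_at (H i) t) ->
  forall j i, {for t, continuous (fun s => (Gmx a b c *m UVW H s) j i : C)}.
Proof.
move=> hH; apply: (continuous_mulmx (K := R[i])) => j i.
have h1 := holomorphic_derive1 (hH i); have h2 := holomorphic_derive1 h1.
move: (holomorphic_continuous (hH i)) (holomorphic_continuous h1)
  (holomorphic_continuous h2).
case: j => [[|[|[|j]]] jlt] c0 c1 c2; last by exfalso.
- have E s : UVW H s (Ordinal jlt) i = - H i s := mxE _ _ _ _.
  exact (eq_continuous_at (K := R[i]) E (continuousN c0)).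
- have E s : UVW H s (Ordinal jlt) i = - derive1 (H i) s := mxE _ _ _ _.
  exact (eq_continuous_at (K := R[i]) E (continuousN c1)).
- have E s : UVW H s (Ordinal jlt) i = - (2^-1 * derive1 (derive1 (H i)) s) :=
    mxE _ _ _ _.
  apply: (eq_continuous_at (K := R[i]) E).
  apply: continuousN; apply: (@continuousM _ _ (fun=> 2^-1 : C)); last exact c2.
  exact: cst_continuous.
Qed.

Lemma near_mx_neq0 m n (M : C -> 'M[R[i]]_(m, n)) (t : C) :
  (forall i j, {for t, continuous (fun s => M s i j : C)}) ->
  M t != 0 -> \forall s \near t, M s != 0.
Proof.
move=> cM M0; have [i [j Mij]] : exists i j, M t i j != 0.
  apply: contrapT => Mz; move/eqP: M0; apply; apply/matrixP => i j; rewrite mxE.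
  by apply: contrapT => /eqP Mij; apply: Mz; exists i, j.
have : \forall s \near t, M s i j != 0 by apply: (cvgr_neq0 _ (cM i j)).
by apply: filterS => s; apply: contraNneq => ->; rewrite mxE.
Qed.

Lemma near_weval_neq0 (F : @wpoly R g) (M : C -> 'M[R[i]]_(3, g)) (t : C) :
  (forall i j, {for t, continuous (fun s => M s i j : C)}) ->
  weval F (M t) != 0 -> \forall s \near t, weval F (M s) != 0.
Proof.
move=> cM FN.
have cF := continuous_meval (K := R[i]) (F := F)
  (v := fun k s => M s (enum_val k).1 (enum_val k).2) (fun k => cM _ _).
exact: (cvgr_neq0 _ cF FN).
Qed.

End Continuity.

(** * The parametrization and the orbits on the plane model *)

Section PlaneModel.
Variables (R : realType) (X : riemann_surface R) (g d : nat) (f : mpoly 2 rat).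
Variables (h : 'I_g -> mpoly 2 rat) (S : set X) (x y : X -> R[i]^o).
Variable omega : 'I_g -> differential X.
Hypothesis f_degree : msize f = d.+1.
Hypothesis f_yd : mcoeff (mnm_muln (mnm1 ord_max) d) f != 0.
Hypothesis X_model : plane_model f S x y.
Hypothesis omega_hol : forall i, holomorphic_differential (omega i).
Hypothesis omega_h : forall i p, ~ S p -> ev (dy f) (x p) (y p) != 0 ->
  omega i p x = ev (h i) (x p) (y p) / ev (dy f) (x p) (y p).
Local Notation C := (R[i]^o).

Lemma near_not_S p : ~ S p -> \forall q \near p, ~ S q.
Proof.
move=> Sp; have [Sfin _ _ _] := X_model.
have Sc : closed S.
  exact: (accessible_finite_set_closed.1 (hausdorff_accessible (@rs_hausdorff _ X))).
exact: open_nbhs_nbhs (conj (closed_openC Sc) Sp).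
Qed.

Lemma on_smooth_locus p : ~ S p -> smooth_locus f (x p, y p).
Proof. by move=> Sp; have [_ [xy _ _] _ _] := X_model; exact: (xy p Sp). Qed.

Lemma branch_at p : ~ S p -> ev (dy f) (x p) (y p) != 0 ->
  exists G, [/\ branch f (x p) G, local_coordinate p x, G (x p) = y p &
    forall i, \forall q \near p, omega i q x = Hbranch f h G i (x q)].
Proof.
move=> Sp fy; have [_ _ /(_ p Sp fy)[lx [G hG yG]] _] := X_model.
have yp := nbhs_singleton yG.
have GN : ev (dy f) (x p) (G (x p)) != 0 by rewrite -yp.
have GN' : eval2 (K := R[i]) (dy f) (x p) (G (x p)) != 0 by rewrite -evE.
exists G; split => //.
  split => //; apply/(local_coordinateP _ lx); near=> q.
  have <- : y q = G (x q) by near: q.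
  have Sq : ~ S q by near: q; exact: near_not_S.
  by have [] := on_smooth_locus Sq.
move=> i.
have near_fy : \forall t \near x p, ev (dy f) t (G t) != 0.
  have := curve_near_neq0 (holomorphic_is_derive hG) GN'.
  by apply: filterS => t; rewrite evE.
move/(local_coordinateP _ lx) : near_fy => near_fy; near=> q.
have yq : y q = G (x q) by near: q.
have Sq : ~ S q by near: q; exact: near_not_S.
have fq : ev (dy f) (x q) (G (x q)) != 0 by near: q.
by rewrite /Hbranch -yq; apply: omega_h => //; rewrite yq.
Unshelve. all: by end_near. Qed.

(** A chart maps a nonempty open set onto an infinite one, so it cannot lie in the finite set [S].
    The point is found in the interior of [W] so that [W] is still a neighbourhood of it. *)
Lemma exists_not_S (p : X) (W : set X) :
  (\forall q \near p, W q) -> exists2 q, interior W q & ~ S q.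
Proof.
move=> pW; apply: contrapT => WS; have [U [phi [Uphi Up]]] := rs_cover p.
have [Uo phi_inj _ phi_open] := rs_chart Uphi; have [Sfin _ _ _] := X_model.
have WUS : interior W `&` U `<=` S.
  by move=> q [Wq _]; apply: contrapT => Sq; apply: WS; exists q.
have op : open (phi @` (interior W `&` U)).
  by apply: phi_open; [apply: openI => //; exact: open_interior|move=> q []].
apply: (@open_infinite R[i] _ (phi p) op); first by exists p.
exact/finite_image/(sub_finite_set WUS).
Qed.

Lemma exists_dy_neq0 (p : X) (W : set X) : (\forall q \near p, W q) ->
  exists q, [/\ W q, ~ S q & ev (dy f) (x q) (y q) != 0].
Proof.
move=> pW; have [q0 Wq0 Sq0] := exists_not_S pW.
apply: contrapT => noq.
have fy0 q : interior W q -> ~ S q -> ev (dy f) (x q) (y q) = 0.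
  move=> Wq Sq; apply: contrapT => /eqP fyq; apply: noq; exists q.
  by split => //; exact: interior_subset.
(* At a smooth point with f_y = 0 the other partial derivative is nonzero, so y is a local
   coordinate there. *)
have fx : ev (dx f) (x q0) (y q0) != 0.
  have /= [_ [fx|/negP[]]] := on_smooth_locus Sq0; first exact fx.
  exact (introT eqP (fy0 _ Wq0 Sq0)).
have [_ _ _ /(_ q0 Sq0 fx)[ly [G hG xG]]] := X_model.
have xq0 := nbhs_singleton xG.
have near_q : \forall q \near q0, [/\ ~ S q, interior W q & x q = G (y q)].
  near=> q; split; near: q => //; first exact: near_not_S.
  exact: open_nbhs_nbhs (conj (@open_interior _ W) Wq0).
have f0 : \forall t \near y q0, eval2 (K := R[i]) f (G t) t = 0.
  apply/(local_coordinateP _ ly); move: near_q; apply: filterS => q [Sq _ <-].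
  by rewrite -evE; have [] := on_smooth_locus Sq.
have fy00 : \forall t \near y q0, eval2 (K := R[i]) (dy f) (G t) t = 0.
  apply/(local_coordinateP _ ly); move: near_q; apply: filterS => q [Sq Wq <-].
  by rewrite -evE; exact: fy0.
have dG := holomorphic_is_derive hG.
have fxN : eval2 (K := R[i]) (dx f) (G (y q0)) (y q0) != 0 by rewrite -evE -xq0.
have G'0 := root_derive1_eq0 (K := R[i]) dG f0 fy00 fxN.
have Gcst := holomorphic_derive1_eq0 hG G'0.
(* As x is locally constant, f vanishes on an open piece of a vertical line, where it is a nonzero
   polynomial in y. *)
have [P P0 PE] := eval2_section (K := R[i]) (G (y q0)) f_degree f_yd.
case/eqP: P0; apply: (near_root_poly0 (K := R[i]) (c := y q0)).
near=> t; rewrite PE; have <- : G t = G (y q0) by near: t.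
by near: t.
Unshelve. all: by end_near. Qed.

Lemma param_image_sub_Gorbits : param_image f h `<=` Gorbits omega.
Proof.
move=> P [x0 [y0 [a [b [c [br a0 Pc]]]]]].
have [_ [_ _ surj] _ _] := X_model.
have fxy : ev f x0 (y0 x0) = 0 by case: br => _ /nbhs_singleton.
have fyN : ev (dy f) x0 (y0 x0) != 0 by case: br.
(* Nonvanishing of f_y puts the point on the smooth locus, hence in the image of the model. *)
have [|p Sp [xp yp]] := surj (x0, y0 x0); first by split => //; right.
have fyp : ev (dy f) (x p) (y p) != 0 by rewrite xp yp.
have [G [brG lx Gp omegaG]] := branch_at Sp fyp.
(* The branch [y0] is arbitrary; by uniqueness of roots it agrees near [x p] with the one coming
   from the surface. *)
have GE : \forall t \near x p, G t = y0 t.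
  rewrite xp in brG Gp *.
  apply: (eval2_root_unique (K := R[i]) (p := f)).
  - by case: brG => /holomorphic_continuous.
  - by case: br => /holomorphic_continuous.
  - by rewrite Gp.
  - by rewrite -evE.
  - exact: branch_root brG.
  - exact: branch_root br.
exists p, x, (Hbranch f h y0), a, b, c.
split; [exact lx| |exact a0|by rewrite xp; exact Pc].
move=> i; move/(local_coordinateP _ lx) : GE => GE; near=> q.
have -> : omega i q x = Hbranch f h G i (x q) by near: q; exact: omegaG.
by rewrite /Hbranch; have -> : G (x q) = y0 (x q) by near: q.
Unshelve. all: by end_near. Qed.

Lemma Gorbits_sub_closed (Z : set (WP R g)) : zariski_closed Z ->
  param_image f h `<=` Z -> Gorbits omega `<=` Z.
Proof.
move=> [I Ihom ->] sub P [p [z [H [a [b [c [lz HE a0 Pc]]]]]]] F IF.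
have Fhom := Ihom F IF.
apply/eqP; rewrite (weval_wcoords Fhom Pc); apply/negPn/negP => FN.
have [nzP _] := Pc.
have hH i : holomorphic_at (H i) (z p).
  have [_ /(_ p z lz)[H' hH' H'E]] := omega_hol i.
  apply: holomorphic_near_eq hH'; apply/(local_coordinateP _ lz); near=> q.
  have <- : omega i q z = H' (z q) by near: q.
  by near: q; exact: HE.
pose M t := Gmx a b c *m UVW H t.
have cM := continuous_Gmx_UVW (a := a) (b := b) (c := c) hH.
have /(local_coordinateP _ lz) FN' := near_weval_neq0 cM FN.
have /(local_coordinateP _ lz) MN := near_mx_neq0 cM nzP.
(* The expression of [omega] must hold around each nearby [q], because its derivatives are compared
   there. *)
have HE' : \forall q \near p, forall i, \forall r \near q, omega i r z = H i (z r).
  by apply: filter_forall => i; exact: near_join (HE i).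
have good : \forall q \near p, [/\ weval F (M (z q)) != 0, M (z q) != 0,
    local_coordinate q z & forall i, \forall r \near q, omega i r z = H i (z r)].
  near=> q; split; near: q; [exact FN'|exact MN|exact: local_coordinate_near|exact HE'].
(* With [a], [b], [c] fixed, [F] stays nonzero for nearby points, among them one with f_y nonzero;
   there the orbit point is a value of the parametrization, a contradiction. *)
have [q [[FqN MqN lzq HzEq] Sq fyq]] := exists_dy_neq0 good.
have [G [brG lx Gq omegaG]] := branch_at Sq fyq.
have [a' [b' [c' [a'0 UVWE]]]] := UVW_local_coordinates omega_hol lzq lx HzEq omegaG.
have ME : M (z q) = param f h (x q) G (a * a') (b * a' + a ^+ 2 * b')
    (c * a' + 6 * a * b * b' + a ^+ 3 * c').
  by rewrite /M UVWE mulmxA mul_Gmx.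
(* Nonvanishing of the matrix near [p] is what makes it define a projective point at [q]. *)
pose N : wcone := exist (fun L : 'M[R[i]]_(3, g) => is_true (L != 0)) _ MqN.
have PqC : wcoords (\pi_(WP R g) N)%qT (M (z q)) by exists MqN.
have /sub/(_ F IF)/eqP : param_image f h (\pi_(WP R g) N)%qT.
  exists (x q), G, (a * a'), (b * a' + a ^+ 2 * b'),
    (c * a' + 6 * a * b * b' + a ^+ 3 * c').
  split; [exact brG|exact (mulf_neq0 a0 a'0)|by rewrite -ME].
rewrite (weval_wcoords Fhom PqC); exact/negP.
Unshelve. all: by end_near. Qed.

End PlaneModel.

Theorem corollary3p2 (R : realType) (X : riemann_surface R) (g d : nat)
    (f : mpoly 2 rat) (h : 'I_g -> mpoly 2 rat)
    (S : set X) (x y : X -> R[i]^o) (omega : 'I_g -> differential X)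
    (K : fieldType) (iota : {rmorphism mpoly 2 rat -> K})
    (X_compact : compact [set: X])
    (f_irreducible : irreducible_elt f)
    (f_degree : msize f = d.+1)
    (f_yd : mcoeff (mnm_muln (mnm1 ord_max) d) f != 0)
    (X_model : plane_model f S x y)
    (omega_basis : differential_basis omega)
    (omega_h : forall i p, ~ S p -> ev (dy f) (x p) (y p) != 0 ->
       omega i p x = ev (h i) (x p) (y p) / ev (dy f) (x p) (y p))
    (K_frac : is_fraction_field iota f) :
  zariski_dense_in (param_image f h) (dubrovin_threefold omega) /\
  coordinates_in_Kabc iota R f h.
Proof.
have [omega_hol _] := omega_basis; split; last exact: param_coordinates_in_Kabc.
split.
  apply: sub_smallest; exact: param_image_sub_Gorbits X_model omega_h.
(* A closed set containing the image contains all orbits, hence their closure. *)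
move=> P PD Z [Zc Zsub]; apply: PD; split => //.
exact: (Gorbits_sub_closed f_degree f_yd X_model omega_hol omega_h).
Qed.
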